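(* There exist an absolute constant $C>0$ and a function $\epsilon(k,q,\delta)\ge0$ such that for each fixed $k$, $\epsilon(k,q,\delta)\to0$ as $q\to\infty$ and $\delta\to0$, with the following property. Let $\pi$ be drawn from a distribution over permutations of $[n]$ satisfying the $(p,q,\delta)$-block-independence property for some $p\ge k$ and $\delta\le k^{-1/2}$. Then for every assignment of nonnegative values to the items, $\mathbb E[\mathrm{val}(\mathcal A)]\ge\bigl(1-Ck^{-1/3}-\epsilon(k,q,\delta)\bigr)\mathrm{val}(\mathcal O)$, where $\mathcal A$ is the set selected by $\mathrm{ALG}(n,k,q)$ and $\mathcal O$ is the set of $k$ highest-valued items.
   Context: Multiple-choice ($k$-uniform matroid) secretary problem: items $[n]$ with nonnegative values assigned by an adversary arrive in order $\pi$ ($\pi(i)$ is the arrival time of item $i$); an online algorithm irrevocably selects at most $k$ items; $\mathrm{val}(T)$ is the total value of a set $T$. $(p,q,\delta)$-block-independence: partition $[n]$ into $q$ consecutive disjoint blocks $B_1,\dots,B_q$ of sizes between $\lfloor n/q\rfloor$ and $\lceil n/q\rceil$; require $\Pr[\pi(x_i)\in B_{b_i}\ \forall i\in[p]]\ge(1-\delta)q^{-p}$ for all distinct $x_1,\dots,x_p$ and all $b_1,\dots,b_p\in[q]$. Algorithm $\mathrm{ALG}(n',k',q')$ operates on the items arriving in the first $n'$ positions, may select $k'$ items, and uses $q'$ blocks (it is assumed throughout that $n'$ is a multiple of $q'$). If $k'=1$ it is the standard secretary algorithm on this prefix: reject items in the first $n'/e$ positions, then select the first item whose value exceeds all values seen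 so far. If $k'>1$: draw $\tau\sim\mathrm{Binom}(q',\frac12)$ and run $\mathrm{ALG}(\frac{\tau}{q'}n',\lfloor k'/2\rfloor,\tau)$ on the first $\frac{\tau}{q'}n'$ positions; afterwards, at positions $\frac{\tau}{q'}n'+1,\dots,n'$, accept every item whose value exceeds the $\lfloor k'/2\rfloor$-th highest value among the items that arrived in positions $1,\dots,\frac{\tau}{q'}n'$ (taken as $0$ if fewer than $\lfloor k'/2\rfloor$ such items), until $k'$ items have been selected or position $n'$ is reached. The output is the union of the items selected by the recursive call and those accepted after the threshold.
   Formalization: Comparisons ''exceeds'' between items break ties by a fixed item order, since with strict comparison the claim fails when all values are equal; also k ≥ 1, p ≤ n (so that p distinct items exist) and q dividing n are explicit. *)

(* Defs.v *)
From HB Require Import structures.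
From mathcomp Require Export all_boot all_order all_fingroup all_algebra.
From mathcomp Require Export all_classical all_reals all_analysis.
Export Order.TTheory GRing.Theory Num.Theory.
Export numFieldNormedType.Exports.

Set Implicit Arguments.
Unset Strict Implicit.
Unset Printing Implicit Defensive.

Local Open Scope ring_scope.

(* Discrete probability distributions on a finite type, as mass functions. *)
Section Distributions.
Variable R : realType.

Definition is_distr (T : finType) (d : T -> R) : Prop :=
  (forall x, 0 <= d x) /\ \sum_x d x = 1.

Definition prob (T : finType) (d : T -> R) (E : pred T) : R :=
  \sum_(x | E x) d x.

Definition expect (T : finType) (d : T -> R) (f : T -> R) : R :=
  \sum_x d x * f x.

Definition dret (T : finType) (x : T) : T -> R := fun y => (y == x)%:R.

Definition dbind (T U : finType) (d : T -> R) (f : T -> U -> R) : U -> R :=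
  fun u => \sum_x d x * f x u.

Definition dbinomial (m : nat) : 'I_m.+1 -> R :=
  fun t => binomial_pmf m (2^-1 : R) t.

End Distributions.

Arguments dret R {T} x.
Arguments dbinomial R m : clear implicits.

(* An arrival order is a permutation [pi] of the items 'I_n, [pi x] being the
   arrival time of item [x].  Times are 0-based: [pi x = t] means that [x]
   arrives in position [t + 1]. *)
Section BlockIndependence.
Variables (R : realType) (n : nat).

(* [blk t] is the index of the block containing time [t]; monotonicity says
   that the blocks are consecutive.  (n + q.-1) %/ q is the ceiling of n/q. *)
Definition consecutive_blocks (q : nat) (blk : 'I_n -> 'I_q) : Prop :=
  (forall s t : 'I_n, (s <= t)%N -> (blk s <= blk t)%N) /\
  (forall b : 'I_q,
     (n %/ q <= #|[set t | blk t == b]| <= (n + q.-1) %/ q)%N).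

Definition block_independent (p q : nat) (delta : R) (mu : 'S_n -> R) : Prop :=
  exists2 blk : 'I_n -> 'I_q, consecutive_blocks blk &
    forall (x : 'I_p -> 'I_n) (b : 'I_p -> 'I_q), injective x ->
      (1 - delta) * q%:R ^- p
        <= prob mu (fun pi => [forall i, blk (pi (x i)) == b i]).

End BlockIndependence.

Section Algorithm.
Variables (R : realType) (n : nat) (v : 'I_n -> R).

Definition val_set (T : {set 'I_n}) : R := \sum_(x in T) v x.

(* "The value of x exceeds that of y".  Ties are broken by the item labels, as
   is needed for the strict comparisons of the algorithm when values repeat;
   for pairwise distinct values this is just [v y < v x]. *)
Definition exceeds (x y : 'I_n) : bool :=
  (v y < v x) || ((v y == v x) && (x < y)%N).

Definition top_items (k : nat) : {set 'I_n} :=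
  [set x | (#|[set y | exceeds y x]| < k)%N].

Variable pi : 'S_n.

Definition arrivals : seq 'I_n := [seq (pi^-1)%g t | t <- enum 'I_n].

Definition arrived (m : nat) : {set 'I_n} := [set x | (pi x < m)%N].

(* Position (pi x).+1 is among the first n'/e positions iff
   (pi x).+1 <= n'/e. *)
Definition secretary (n' : nat) : {set 'I_n} :=
  if [seq x <- arrivals | [&& (pi x < n')%N,
                              n'%:R / expR 1 < (pi x).+1%:R :> R
                            & [forall y, (pi y < pi x)%N ==> exceeds x y]]]
    is x :: _ then [set x] else finset.set0.

(* The item with the j-th highest value among those in the first m positions
   (j > 0), if there is one. *)
Definition jth_highest (j m : nat) : option 'I_n :=
  [pick y in arrived m | #|[set z in arrived m | exceeds z y]| == j.-1].

(* [None] stands for the threshold value 0. *)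
Definition above (thr : option 'I_n) (x : 'I_n) : bool :=
  if thr is Some y then exceeds x y else 0 < v x.

(* S enlarged, in order of arrival, by the items in positions m+1, ..., n' that
   lie above the threshold, as long as fewer than k' items are selected. *)
Definition accept (m n' k' : nat) (thr : option 'I_n) (S : {set 'I_n}) :
    {set 'I_n} :=
  foldl (fun (T : {set 'I_n}) x =>
           if (#|T| < k')%N && above thr x then x |: T else T) S
        [seq x <- arrivals | (m <= pi x < n')%N].

(* The first argument only bounds the recursion depth; see [ALG_eq]. *)
Fixpoint ALG_rec (fuel n' k' q' : nat) : {set 'I_n} -> R :=
  if fuel is fuel'.+1 then
    if k' == 1%N then dret R (secretary n')
    else
      dbind (dbinomial R q') (fun tau : 'I_q'.+1 =>
        let m := (tau * (n' %/ q'))%N in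
        dbind (ALG_rec fuel' m k'./2 tau) (fun S =>
          dret R (accept m n' k' (jth_highest k'./2 m) S)))
  else dret R finset.set0.

(* Distribution of the set selected by ALG(n', k', q') for the arrival order
   pi, over the internal randomness of the algorithm. *)
Definition ALG (n' k' q' : nat) : {set 'I_n} -> R := ALG_rec k' n' k' q'.

Lemma ALG_rec_fuel (f g n' k' q' : nat) : (0 < k')%N -> (k' <= f)%N ->
  (k' <= g)%N -> ALG_rec f n' k' q' = ALG_rec g n' k' q'.
Proof.
elim: f g n' k' q' => [|f IH] [|g] n' k' q' k0; do ?by case: k' k0.
move=> kf kg /=; case: eqP => // k1.
have k2 : (1 < k')%N by rewrite ltn_neqAle k0 andbT eq_sym; apply/eqP.
have h1 : (0 < k'./2)%N by rewrite half_gt0.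
have h2 : (k'./2 < k')%N by rewrite ltn_half_double -addnn -addn1 leq_add2l.
congr (dbind _ _); apply/funext => tau; congr (dbind _ _).
by apply: IH => //; rewrite -ltnS (leq_trans h2).
Qed.

Lemma ALG1 (n' q' : nat) : ALG n' 1 q' = dret R (secretary n').
Proof. by []. Qed.

Lemma ALG_eq (n' k' q' : nat) : (1 < k')%N ->
  ALG n' k' q' =
    dbind (dbinomial R q') (fun tau : 'I_q'.+1 =>
      let m := (tau * (n' %/ q'))%N in
      dbind (ALG m k'./2 tau) (fun S =>
        dret R (accept m n' k' (jth_highest k'./2 m) S))).
Proof.
case: k' => [|[|k]] // _; rewrite {1}/ALG.
change (ALG_rec k.+2 n' k.+2 q') with
  (dbind (dbinomial R q') (fun tau : 'I_q'.+1 =>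
     let m := (tau * (n' %/ q'))%N in
     dbind (ALG_rec k.+1 m k.+2./2 tau) (fun S =>
       dret R (accept m n' k.+2 (jth_highest k.+2./2 m) S)))).
congr (dbind _ _); apply/funext => tau; congr (dbind _ _).
by apply: ALG_rec_fuel => //; rewrite /= ltnS leq_half_double -addnn leqW ?leq_addr.
Qed.

End Algorithm.

(* E[val(A)] over both the arrival order and the coins of the algorithm. *)
Definition expected_val (R : realType) (n k q : nat) (mu : 'S_n -> R)
    (v : 'I_n -> R) : R :=
  expect (dbind mu (fun pi => ALG v pi n k q)) (val_set v).

(* Main.v *)
(** Unrolling the recursion, level [j] has a budget of [k / 2^j] items, uses about
    [q / 2^j] blocks, and accepts items in the second half of these blocks against
    the threshold given by the first half.  An item of rank at most [(1 - ep) k]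
    that arrives in the first [1 - 4 ep] part of this second half is accepted
    unless one of three counts deviates from its mean by a relative [ep / 2]: the
    better items in the first half (the item must beat the threshold), and the
    items of rank at most [(1 + ep) k] in the first half and in the window (so
    that all competitors have such a rank, and there are too few of them to use
    up the budget).  Conditionally on the block of the item these counts have the
    variance of pairwise independent sums, hence marginals of order three and
    Chebyshev's inequality suffice; in particular the items of rank beyond [k]
    are controlled although block independence is only available for [k] items
    at a time.  The loss at level [j] is [2^-j (O(ep) + O(2^j / (k ep^2)))], and
    [ep = k^(-1/3) (3/2)^j] makes the total [O(k^(-1/3))].  Since [k] is fixed
    while [q] grows, the random block counts [tau] can be replaced by
    [q / 2^j (1 + o(1))], and the error term [eps] may be taken to be 0 for
    large [q] and small [delta], and 1 otherwise. *)
Require Import Defs.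
From mathcomp Require Import ring lra zify.
Set Implicit Arguments.
Unset Strict Implicit.
Unset Printing Implicit Defensive.
Local Open Scope ring_scope.

(** * Moments of the fair binomial distribution *)

Section BinomialMoments.
Variable R : realType.

Lemma dbinomialE m (t : 'I_m.+1) :
  dbinomial R m t = 'C(m, t)%:R / 2 ^+ m.
Proof.
rewrite /dbinomial /binomial_pmf /unstable.onem.
have -> : 1 - 2^-1 = 2^-1 :> R by lra.
have tm : (t <= m)%N by rewrite -ltnS.
by rewrite -exprD subnKC // exprVn -mulr_natl.
Qed.

Lemma dbinomial_ge0 m (t : 'I_m.+1) : 0 <= dbinomial R m t.
Proof. by rewrite dbinomialE divr_ge0 ?exprn_ge0. Qed.

(** Pascal's rule in summed form: one more coin either keeps the count or raises it by one. This is
    the induction step for both binomial sums below. *)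
Lemma sum_binS m (f : nat -> R) :
  \sum_(i < m.+2) 'C(m.+1, i)%:R * f i =
  \sum_(i < m.+1) 'C(m, i)%:R * (f i + f i.+1).
Proof.
rewrite big_ord_recl /= bin0 mul1r.
under eq_bigr do rewrite binS natrD mulrDl.
rewrite big_split /= big_ord_recr /= bin_small // mul0r addr0 addrA.
have -> : f 0%N + \sum_(i < m) 'C(m, i.+1)%:R * f i.+1 =
   \sum_(i < m.+1) 'C(m, i)%:R * f i :> R.
  by rewrite big_ord_recl bin0 mul1r.
by rewrite -big_split /=; apply: eq_bigr => i _; rewrite mulrDr.
Qed.

Lemma sum_bin m : \sum_(i < m.+1) 'C(m, i)%:R = 2 ^+ m :> R.
Proof.
elim: m => [|m IH]; first by rewrite big_ord1 bin0 expr0.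
have := sum_binS m (fun=> 1).
under eq_bigr do rewrite mulr1; move=> ->.
rewrite -mulr_suml IH exprS; ring.
Qed.

(** With [x = 2 * i - m], the extra coin replaces [x ^ 2] by [(x - 1) ^ 2 + (x + 1) ^ 2 = 2 * x ^ 2
    + 2]. Doubling the count avoids halves and makes the variance [m]. *)
Lemma sum_bin_sqdev m :
  \sum_(i < m.+1) 'C(m, i)%:R * (2 * i%:R - m%:R) ^+ 2
    = m%:R * 2 ^+ m :> R.
Proof.
elim: m => [|m IH].
  by rewrite big_ord1 mulr0 mul0r subrr expr2 !mulr0.
rewrite (sum_binS m (fun i => (2 * i%:R - m.+1%:R) ^+ 2)).
rewrite (eq_bigr (fun i : 'I_m.+1 =>
   2 * ('C(m, i)%:R * (2 * i%:R - m%:R) ^+ 2) + 2 * 'C(m, i)%:R)); last first.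
  by move=> i _; rewrite -!natr1; ring.
rewrite big_split /= -!mulr_sumr IH sum_bin -natr1 exprS; ring.
Qed.

Lemma sum_dbinomial m : \sum_t dbinomial R m t = 1.
Proof.
under eq_bigr do rewrite dbinomialE.
by rewrite -mulr_suml sum_bin divff // expf_neq0.
Qed.

Lemma dbinomial_chebyshev m (c : R) : 0 < c ->
  \sum_(t : 'I_m.+1 | c < `|2 * t%:R - m%:R|) dbinomial R m t <= m%:R / c ^+ 2.
Proof.
move=> c0; rewrite ler_pdivlMr ?exprn_gt0 //.
rewrite [leRHS](_ : _ =
    \sum_(t < m.+1) dbinomial R m t * (2 * t%:R - m%:R) ^+ 2); last first.
  under eq_bigr do rewrite dbinomialE mulrAC.
  by rewrite -mulr_suml sum_bin_sqdev mulfK // expf_neq0.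
rewrite mulr_suml big_mkcond /=; apply: ler_sum => t _.
case: ifP => [ct|_]; last by rewrite mulr_ge0 ?dbinomial_ge0 ?sqr_ge0.
rewrite ler_wpM2l ?dbinomial_ge0 // -[leRHS]real_normK ?num_real //.
by rewrite lerXn2r ?nnegrE ?(ltW c0) ?(ltW ct).
Qed.

End BinomialMoments.

(** * Ranks of items and averages of top values *)

Section Ranks.
Variables (R : realType) (n : nat) (v : 'I_n -> R).

Lemma exceeds_irr x : exceeds v x x = false.
Proof. by rewrite /exceeds ltxx ltnn andbF. Qed.

Lemma exceeds_trans : transitive (exceeds v).
Proof.
move=> y x z; rewrite /exceeds.
case: (ltgtP (v y) (v x)) => //= [yx|xy].
  case: (ltgtP (v z) (v y)) => //= [zy|zy] _; last by rewrite zy yx.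
  by rewrite (lt_trans zy yx).
rewrite xy; case: (ltgtP (v z) (v x)) => //= _ h1 h2.
exact: ltn_trans h1 h2.
Qed.

Lemma exceeds_total x y : x != y -> exceeds v x y || exceeds v y x.
Proof.
rewrite /exceeds => xy; case: (ltgtP (v x) (v y)) => //= _.
by rewrite -neq_ltn.
Qed.

Lemma exceeds_le x y : exceeds v x y -> v y <= v x.
Proof. by case/orP => [/ltW//|/andP[/eqP-> _]]. Qed.

Definition rank_in (A : {set 'I_n}) (x : 'I_n) : nat :=
  #|[set y in A | exceeds v y x]|.

Definition rank (x : 'I_n) : nat := #|[set y | exceeds v y x]|.

Lemma rank_inT x : rank_in [set: 'I_n] x = rank x.
Proof. by apply: eq_card => y; rewrite !inE. Qed.

Lemma rank_in_mono (A : {set 'I_n}) x y : x \in A -> exceeds v x y ->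
  (rank_in A x < rank_in A y)%N.
Proof.
move=> xA xy; apply: proper_card; apply/properP; split.
  apply/fintype.subsetP => z; rewrite !inE => /andP[-> zx] /=.
  exact: exceeds_trans zx xy.
by exists x; rewrite !inE ?xA ?xy // exceeds_irr andbF.
Qed.

Lemma rank_mono x y : exceeds v x y = (rank x < rank y)%N.
Proof.
have mono a b : exceeds v a b -> (rank a < rank b)%N.
  by rewrite -!rank_inT; apply: rank_in_mono; rewrite inE.
apply/idP/idP => [/mono//|xy].
have nxy : x != y by apply: contraTneq xy => ->; rewrite ltnn.
case/orP: (exceeds_total nxy) => // /mono yx.
by move: (ltn_trans xy yx); rewrite ltnn.
Qed.

(** Ranks within [A] are distinct because [exceeds] is a strict total order, and they stay below
    [#|A|]; by pigeonhole they fill the initial segment. *)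
Lemma rank_in_perm (A : {set 'I_n}) :
  perm_eq [seq rank_in A x | x <- enum A] (iota 0 #|A|).
Proof.
have u : uniq [seq rank_in A x | x <- enum A].
  rewrite map_inj_in_uniq ?enum_uniq // => x y.
  rewrite !mem_enum => xA yA exy; apply/eqP; apply: contraT => nxy.
  case/orP: (exceeds_total nxy) => e.
    by move: (rank_in_mono xA e); rewrite exy ltnn.
  by move: (rank_in_mono yA e); rewrite exy ltnn.
have sz : size [seq rank_in A x | x <- enum A] = #|A| by rewrite size_map -cardE.
have sub : {subset [seq rank_in A x | x <- enum A] <= iota 0 #|A|}.
  move=> _ /mapP[x + ->]; rewrite mem_enum mem_iota /= add0n => xA.
  apply: proper_card; apply/properP; split.
    by apply/fintype.subsetP => z; rewrite inE => /andP[].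
  by exists x; rewrite // inE exceeds_irr andbF.
have [//|_ e] := uniq_min_size u sub; first by rewrite size_iota sz.
by apply: uniq_perm => //; apply: iota_uniq.
Qed.

Lemma card_rank_in_lt (A : {set 'I_n}) r :
  #|[set x in A | (rank_in A x < r)%N]| = minn r #|A|.
Proof.
rewrite cardE /enum_mem size_filter -enumT /=.
have -> : count (mem [set x in A | (rank_in A x < r)%N]) (enum 'I_n) =
  count (fun i => i < r)%N [seq rank_in A x | x <- enum A].
  rewrite count_map [in RHS]/enum_mem [RHS]count_filter -enumT.
  apply: eq_count => x.
  by rewrite !inE /= andbC.
rewrite (seq.permP (rank_in_perm A)).
elim: #|A| => [|a IH]; first by rewrite minn0.
rewrite -addn1 iotaD count_cat IH /=; lia.
Qed.

Lemma card_rank_lt r : #|[set x | (rank x < r)%N]| = minn r n.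
Proof.
have -> : minn r n = minn r #|[set: 'I_n]| by rewrite cardsT card_ord.
by rewrite -card_rank_in_lt; apply: eq_card => x; rewrite !inE rank_inT.
Qed.

Lemma rank_in_surj (A : {set 'I_n}) j : (j < #|A|)%N -> exists2 x, x \in A & rank_in A x = j.
Proof.
move=> jA; have : j \in iota 0 #|A| by rewrite mem_iota.
rewrite -(perm_mem (rank_in_perm A)) => /mapP[x + ->].
by rewrite mem_enum; exists x.
Qed.

Lemma rank_ltn x : (rank x < n)%N.
Proof.
have -> : n = #|[set: 'I_n]| by rewrite cardsT card_ord.
apply: proper_card.
by apply/properP; split; [apply: finset.subsetT|exists x; rewrite ?inE ?exceeds_irr].
Qed.

(** Each of the best [l] values dominates each of the next [k - l]; the comparison is summed over
    all such pairs. *)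
Lemma sum_top_average l k : (l <= k)%N -> (k <= n)%N ->
  l%:R * \sum_(x | (rank x < k)%N) v x <= k%:R * \sum_(x | (rank x < l)%N) v x.
Proof.
move=> lk kn.
pose L := [set x | (rank x < l)%N]; pose M := [set x | (l <= rank x < k)%N].
have cL : #|L| = l by rewrite card_rank_lt; lia.
have cM : #|M| = (k - l)%N.
  have := card_rank_lt k.
  have -> : [set x | (rank x < k)%N] = L :|: M.
    by apply/setP => x; rewrite !inE; lia.
  rewrite cardsU disjoint_setI0 ?cards0 ?cL; first by lia.
  by rewrite -setI_eq0; apply/eqP/setP => x; rewrite !inE; lia.
have eK : \sum_(x | (rank x < k)%N) v x =
    \sum_(x in L) v x + \sum_(x in M) v x.
  rewrite (bigID (mem L)) /=; congr (_ + _); apply: eq_bigl => x;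
  rewrite !inE; lia.
have eL : \sum_(x | (rank x < l)%N) v x = \sum_(x in L) v x.
  by apply: eq_bigl => x; rewrite !inE.
rewrite eK eL.
have H : \sum_(x in L) \sum_(y in M) v y <= \sum_(x in L) \sum_(y in M) v x.
  apply: ler_sum => x; rewrite inE => xl; apply: ler_sum => y.
  rewrite inE => /andP[ly _]; apply: exceeds_le; rewrite rank_mono.
  exact: leq_trans xl ly.
move: H; rewrite sumr_const cL.
rewrite [leRHS](eq_bigr (fun x => v x *+ (k - l))); last first.
  by move=> x _; rewrite sumr_const cM.
rewrite sumrMnl -[leLHS]mulr_natl -[leRHS]mulr_natl => H.
have -> : k%:R = l%:R + (k - l)%:R :> R by rewrite -natrD subnKC.
rewrite mulrDl mulrDr; lra.
Qed.

End Ranks.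

(** * Deterministic analysis of one acceptance phase *)

Section Phase.
Variables (R : realType) (n : nat) (v : 'I_n -> R) (pi : 'S_n).

Lemma arrivals_sorted : sorted (fun x y => pi x < pi y)%N (arrivals pi).
Proof.
rewrite /arrivals sorted_map.
have e : relpre (pi^-1)%g (fun x y => pi x < pi y)%N =2 (relpre val ltn).
  by move=> x y /=; rewrite !permKV.
by rewrite (eq_sorted e) -sorted_map val_enum_ord iota_ltn_sorted.
Qed.

Lemma mem_arrivals x : x \in arrivals pi.
Proof. by apply/mapP; exists (pi x); rewrite ?mem_enum // permK. Qed.

Lemma arrivals_uniq : uniq (arrivals pi).
Proof. by rewrite map_inj_uniq ?enum_uniq //; apply: perm_inj. Qed.

Lemma fold_accept_sub k' (P : pred 'I_n) s (S : {set 'I_n}) :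
  S \subset foldl (fun (T : {set 'I_n}) x =>
           if (#|T| < k')%N && P x then x |: T else T) S s.
Proof.
elim: s S => //= y s IH S; apply: fintype.subset_trans (IH _).
by case: ifP => // _; apply: finset.subsetUr.
Qed.

Lemma accept_sub m n' k' thr (S : {set 'I_n}) : S \subset accept v pi m n' k' thr S.
Proof. exact: fold_accept_sub. Qed.

Lemma accept_card m n' k' thr (S : {set 'I_n}) : (#|S| <= k')%N ->
  (#|accept v pi m n' k' thr S| <= k')%N.
Proof.
rewrite /accept; elim: [seq _ <- _ | _] S => //= y s IH S Sk; apply: IH.
case: ifP => // /andP[Sk' _]; rewrite cardsU1; apply: leq_trans Sk'.
by rewrite -add1n leq_add2r; case: (_ \notin _).
Qed.

(** Each step moves at most one candidate into the selection, so the selected items plus the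
    candidates still ahead of [x] never grow in number, and budget is left when [x] is reached. *)
Lemma mem_fold_accept k' (P : pred 'I_n) s1 s2 x (S : {set 'I_n}) :
  P x -> (#|S| + count P s1 < k')%N ->
  x \in foldl (fun (T : {set 'I_n}) x =>
           if (#|T| < k')%N && P x then x |: T else T) S (s1 ++ x :: s2).
Proof.
move=> Px; elim: s1 S => [|y s IH] S /=.
  rewrite addn0 Px andbT => ->; apply: (fintype.subsetP (fold_accept_sub _ _ _ _)).
  by rewrite !inE eqxx.
move=> lt; apply: IH; apply: leq_ltn_trans lt; rewrite addnA leq_add2r.
case: ifP => [/andP[_ Py]|_]; last exact: leq_addr.
by rewrite cardsU1 addnC leq_add2l Py; case: (_ \notin _).
Qed.

Lemma mem_accept m n' k' thr x (S : {set 'I_n}) :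
  (m <= pi x < n')%N -> above v thr x ->
  (#|S| + #|[set y | [&& (m <= pi y < pi x)%N & above v thr y]]| < k')%N ->
  x \in accept v pi m n' k' thr S.
Proof.
move=> mx ax lt; rewrite /accept.
set s := [seq _ <- _ | _].
have xs : x \in s by rewrite mem_filter mx mem_arrivals.
have us : uniq s by rewrite filter_uniq // arrivals_uniq.
have ss : sorted (fun x y => pi x < pi y)%N s.
  apply: sorted_filter arrivals_sorted => a b c; exact: ltn_trans.
have sm y : y \in s -> (m <= pi y)%N by rewrite mem_filter => /andP[/andP[]].
case/splitPr: xs us ss sm => s1 s2 us ss sm; apply: mem_fold_accept => //.
apply: leq_ltn_trans lt; rewrite leq_add2l -size_filter.
have us1 : uniq s1 by move: us; rewrite cat_uniq => /andP[].
rewrite -(card_uniqP (filter_uniq (above v thr) us1)).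
apply/subset_leq_card/fintype.subsetP => y; rewrite mem_filter inE.
case/andP=> -> ys1; rewrite andbT sm /=; last by rewrite mem_cat ys1.
move: ss; rewrite sorted_pairwise; last by move=> a b c; exact: ltn_trans.
rewrite pairwise_cat => /and3P[/allrelP H _ _].
by apply: H => //; rewrite inE eqxx.
Qed.

(** If [x] did not exceed the threshold item, that item and the [h - 1] early items above it would
    be [h] early items better than [x]. The hypothesis [0 < v x] serves the default threshold 0. *)
Lemma above_threshold h m x : (0 < h)%N -> (m <= pi x)%N -> 0 < v x ->
  (#|[set y | (rank v y < rank v x)%N && (pi y < m)%N]| < h)%N ->
  above v (jth_highest v pi h m) x.
Proof.
move=> h0 mx vx lt; rewrite /jth_highest; case: pickP => [z|//] /=.
rewrite inE => /andP[zm /eqP cz]; apply: contraLR lt => nxz.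
have zx : exceeds v z x.
  have : z != x by apply: contraTneq zm => ->; rewrite -leqNgt.
  by move/(exceeds_total v); rewrite (negPf nxz) orbF.
rewrite -leqNgt -(prednK h0) -cz.
have -> : #|[set z0 in arrived pi m | exceeds v z0 z]|.+1 =
   #|z |: [set z0 in arrived pi m | exceeds v z0 z]|.
  by rewrite cardsU1 !inE exceeds_irr andbF.
apply/subset_leq_card/fintype.subsetP => y; rewrite !inE -rank_mono.
case/orP => [/eqP->|/andP[-> yz]]; first by rewrite zx zm.
by rewrite (exceeds_trans yz zx).
Qed.

(** With [h] early items of rank below [r], the threshold item exists and has rank below [r], hence
    so does everything above it. If [n <= r], all ranks are below [r] anyway. *)
Lemma above_threshold_rank h m r y : (0 < h)%N ->
  (n <= r)%N || (h <= #|[set z | (rank v z < r)%N && (pi z < m)%N]|)%N ->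
  above v (jth_highest v pi h m) y -> (rank v y < r)%N.
Proof.
move=> h0 /orP[nr _|hc]; first exact: leq_trans (rank_ltn v y) nr.
rewrite /jth_highest; case: pickP => [z|no] /=.
  rewrite inE => /andP[zm /eqP cz] yz.
  rewrite ltnNge; apply/negP => ry.
  have : (h <= h.-1)%N; last by lia.
  rewrite -cz; apply: leq_trans hc _.
  apply/subset_leq_card/fintype.subsetP => t; rewrite !inE => /andP[tr ->] /=.
  rewrite rank_mono; apply: leq_trans tr (leq_trans ry _).
  by rewrite leq_eqVlt -rank_mono yz orbT.
have hA : (h.-1 < #|arrived pi m|)%N.
  rewrite prednK //; apply: leq_trans hc _.
  by apply/subset_leq_card/fintype.subsetP => t; rewrite !inE => /andP[].
have [z zA zr] := rank_in_surj v hA.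
by have := no z; rewrite /= zA -/(rank_in v _ _) zr eqxx.
Qed.

End Phase.

(** * The random output of the algorithm for a fixed arrival order *)

Section Selection.
Variables (R : realType) (n : nat) (v : 'I_n -> R) (pi : 'S_n).

Lemma probE (T : finType) (d : T -> R) (E : pred T) :
  prob d E = \sum_x d x * (E x)%:R.
Proof.
rewrite /prob big_mkcond; apply: eq_bigr => x _.
by case: (E x); rewrite ?mulr1 ?mulr0.
Qed.

Lemma sum_dret (T : finType) (x : T) (f : T -> R) :
  \sum_y dret R x y * f y = f x.
Proof.
rewrite (bigD1 x) //= big1 => [|y /negPf yx]; last by rewrite /dret yx mul0r.
by rewrite /dret eqxx mul1r addr0.
Qed.

Lemma sum_dret1 (T : finType) (x : T) : \sum_y dret R x y = 1.
Proof.
by have := sum_dret x (fun=> 1); under eq_bigr do rewrite mulr1.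
Qed.

Lemma sum_dbind (T U : finType) (d : T -> R) (e : T -> U -> R) (f : U -> R) :
  \sum_u dbind d e u * f u = \sum_x d x * \sum_u e x u * f u.
Proof.
rewrite /dbind; under eq_bigr do rewrite mulr_suml.
rewrite exchange_big /=; apply: eq_bigr => x _.
by rewrite mulr_sumr; apply: eq_bigr => u _; rewrite mulrA.
Qed.

Lemma ALG_rec_distr f n' k' q' : is_distr (ALG_rec v pi f n' k' q').
Proof.
elim: f n' k' q' => [|f IH] n' k' q' /=; last case: ifP => _.
- split=> [S|]; first by rewrite /dret.
  exact: sum_dret1.
- split=> [S|]; first by rewrite /dret.
  exact: sum_dret1.
split=> [S|].
  apply: sumr_ge0 => t _; rewrite mulr_ge0 ?dbinomial_ge0 //.
  by apply: sumr_ge0 => S' _; rewrite mulr_ge0 ?(IH _ _ _).1 // /dret.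
rewrite (eq_bigr _ (fun S _ => esym (mulr1 _))) sum_dbind -[RHS](sum_dbinomial R q'); apply: eq_bigr => t _.
rewrite sum_dbind.
rewrite (eq_bigr (ALG_rec v pi f (t * (n' %/ q')) k'./2 t)).
  by rewrite (IH _ _ _).2 mulr1.
by move=> S _; rewrite (sum_dret _ (fun=> 1)) mulr1.
Qed.

Lemma ALG_rec_card f n' k' q' S :
  ALG_rec v pi f n' k' q' S != 0 -> (#|S| <= k')%N.
Proof.
elim: f n' k' q' S => [|f IH] n' k' q' S /=; last case: ifP => [/eqP->|_].
- by rewrite /dret; case: (S =P _) => [->|]; rewrite ?cards0 ?eqxx.
- rewrite /dret; case: (S =P _) => [->|]; rewrite ?eqxx // => _.
  by rewrite /secretary; case: [seq _ <- _ | _] => [|x s]; rewrite ?cards0 ?cards1.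
apply: contra_neqT => Sk; rewrite /dbind big1 // => t _.
rewrite big1 ?mulr0 // => S' _; rewrite /dret.
case: eqP => [eS|]; last by rewrite mulr0.
case: (eqVneq (ALG_rec v pi f (t * (n' %/ q')) k'./2 t S') 0) => [->|/IH c].
  by rewrite mul0r.
case/negP: Sk; rewrite eS; apply: accept_card; apply: leq_trans c _.
by rewrite leq_half_double -addnn leqW ?leq_addr.
Qed.

Definition psel n' k' q' x : R := prob (ALG v pi n' k' q') (fun S => x \in S).

Lemma psel_ge0 n' k' q' x : 0 <= psel n' k' q' x.
Proof. by apply: sumr_ge0 => S _; apply: (ALG_rec_distr _ _ _ _).1. Qed.

Lemma psel_rec n' k' q' x : (1 < k')%N ->
  psel n' k' q' x = \sum_(t < q'.+1) dbinomial R q' t *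
    \sum_S ALG v pi (t * (n' %/ q')) k'./2 t S *
      (x \in accept v pi (t * (n' %/ q')) n' k'
         (jth_highest v pi k'./2 (t * (n' %/ q'))) S)%:R.
Proof.
move=> k1; rewrite /psel probE ALG_eq // sum_dbind; apply: eq_bigr => t _.
rewrite sum_dbind; congr (_ * _); apply: eq_bigr => S _.
by rewrite (sum_dret _ (fun S : {set 'I_n} => (x \in S)%:R)).
Qed.

Lemma psel_rec_old m n' k' h q' thr x :
  psel m h q' x <=
  \sum_S ALG v pi m h q' S * (x \in accept v pi m n' k' thr S)%:R.
Proof.
rewrite /psel probE; apply: ler_sum => S _.
rewrite ler_wpM2l ?(ALG_rec_distr _ _ _ _).1 // ler_nat.
case: (boolP (x \in S)) => // xS.
by rewrite (fintype.subsetP (accept_sub _ _ _ _ _ _ _) _ xS).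
Qed.

(** Only sets of size at most [h] carry mass in the recursive call, so the hypothesis applies
    wherever it matters. *)
Lemma psel_rec_new m n' k' h q' thr x :
  (forall S : {set 'I_n}, (#|S| <= h)%N -> x \in accept v pi m n' k' thr S) ->
  \sum_S ALG v pi m h q' S * (x \in accept v pi m n' k' thr S)%:R = 1.
Proof.
move=> H; rewrite -[RHS](ALG_rec_distr h m h q').2; apply: eq_bigr => S _.
rewrite -/(ALG v pi m h q').
case: (eqVneq (ALG v pi m h q' S) 0) => [->|/ALG_rec_card c].
  by rewrite mul0r.
by rewrite H // mulr1.
Qed.

End Selection.

(** * One recursion step in terms of blocks *)

Section Blocks.
Variables (R : realType) (n : nat) (v : 'I_n -> R) (q g : nat).
Variable blk : 'I_n -> 'I_q.
Hypothesis blkE : forall (t : 'I_n) c, (c <= q)%N -> (t < c * g)%N = (blk t < c)%N.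

(* Item [x] arrives in blocks [t, .., w - 1], beats the threshold computed from
   the first [t] blocks, and cannot be crowded out: everything above that
   threshold has rank below [r], and fewer than [h] such competitors arrive in
   the window. *)
Definition good (pi : 'S_n) (h r t w : nat) (x : 'I_n) : bool :=
  [&& (t <= blk (pi x) < w)%N,
      (#|[set y | (rank v y < rank v x)%N && (blk (pi y) < t)%N]| < h)%N,
      (n <= r)%N ||
        (h <= #|[set y in [set y | (rank v y < r)%N] :\ x | (blk (pi y) < t)%N]|)%N
    & (#|[set y in [set y | (rank v y < r)%N] :\ x
                | (t <= blk (pi y) < w)%N]| < h)%N].

(** The recursive call has used at most [h] places and fewer than [h] competitors precede [x] in the
    window, so fewer than [2 * h <= k'] places are taken when [x] arrives. *)
Lemma good_accept (pi : 'S_n) h k' r t w q' x (S : {set 'I_n}) :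
  (0 < h)%N -> (h.*2 <= k')%N -> (t <= w <= q')%N -> (q' <= q)%N -> 0 < v x ->
  good pi h r t w x -> (#|S| <= h)%N ->
  x \in accept v pi (t * g) (q' * g) k' (jth_highest v pi h (t * g)) S.
Proof.
move=> h0 hk /andP[tw wq'] q'q vx /and4P[/andP[tx xw] cx cr cw] cS.
have tq : (t <= q)%N by lia.
have mx : (t * g <= pi x)%N by rewrite leqNgt blkE // -leqNgt.
apply: mem_accept.
- rewrite mx blkE //; lia.
- apply: above_threshold => //; apply: leq_ltn_trans cx.
  by apply/subset_leq_card/fintype.subsetP => y; rewrite !inE blkE.
have H : (#|S| + #|[set y | (t * g <= pi y < pi x)%N &
    above v (jth_highest v pi h (t * g)) y]| < h + h)%N.
  rewrite -addnS; apply: leq_add => //; apply: leq_ltn_trans cw.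
  apply/subset_leq_card/fintype.subsetP => y; rewrite !inE => /andP[/andP[ty yx] ab].
  have -> /= : y != x by apply: contraTneq yx => ->; rewrite ltnn.
  apply/andP; split.
    apply: above_threshold_rank ab => //; case/orP: cr => [->//|cr].
    apply/orP; right; apply: leq_trans cr _.
    apply/subset_leq_card/fintype.subsetP => z; rewrite !inE blkE //.
    by case/andP => /andP[_ ->].
  rewrite leqNgt -blkE // -leqNgt ty /= -blkE; last by lia.
  by apply: ltn_trans yx _; rewrite blkE //; lia.
by apply: leq_trans H _; rewrite addnn.
Qed.

(** The indicator confines the credit to the first [q'] blocks. Credit inherited from the recursive
    call and credit for good items then concern disjoint ranges of blocks and can be added. *)
Definition sel (pi : 'S_n) (k' q' : nat) (x : 'I_n) : R :=
  (blk (pi x) < q')%N%:R * psel v pi (q' * g) k' q' x.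

Lemma sel_ge0 pi k' q' x : 0 <= sel pi k' q' x.
Proof. by rewrite mulr_ge0 ?psel_ge0. Qed.

(** An item before block [t] keeps its chance from the recursive call; a good item, which lies in
    block [t] or later, is accepted with certainty. The factor [v x] admits items of value 0, which
    need not pass the default threshold. *)
Lemma sel_step (pi : 'S_n) k' r (w : nat -> nat) q' x :
  (1 < k')%N -> (0 < q' <= q)%N ->
  (forall t, (t <= q')%N -> (t <= w t <= q')%N) -> 0 <= v x ->
  \sum_(t < q'.+1) dbinomial R q' t *
     (v x * sel pi k'./2 t x + v x * (good pi k'./2 r t (w t) x)%:R)
  <= v x * sel pi k' q' x.
Proof.
move=> k1 /andP[q0 q'q] wq; rewrite le_eqVlt => /orP[/eqP<-|vx].
  by rewrite big1 ?mul0r // => t _; rewrite !mul0r addr0 mulr0.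
rewrite /sel psel_rec // !mulr_sumr; apply: ler_sum => t _.
rewrite mulKn //.
rewrite [leRHS](_ : _ = dbinomial R q' t * (v x * ((blk (pi x) < q')%N%:R *
  \sum_S ALG v pi (t * g) k'./2 t S *
      (x \in accept v pi (t * g) (q' * g) k'
         (jth_highest v pi k'./2 (t * g)) S)%:R))); last by ring.
rewrite ler_wpM2l ?dbinomial_ge0 // -mulrDr ler_pM2l //.
have tq : (t <= q')%N by rewrite -ltnS.
have /andP[tw wq'] := wq _ tq.
case: (ltnP (blk (pi x)) t) => xt.
  have -> : good pi k'./2 r t (w t) x = false by rewrite /good leqNgt xt.
  rewrite (leq_trans xt tq) addr0 !mul1r; exact: psel_rec_old.
rewrite mul0r add0r; case: (boolP (good _ _ _ _ _ _)) => [G|_]; last first.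
  rewrite mulr_ge0 // sumr_ge0 // => S _; rewrite mulr_ge0 //.
  exact: (ALG_rec_distr _ _ _ _ _ _).1.
have xq : (blk (pi x) < q')%N.
  by case/and4P: (G) => /andP[_ xw] _ _ _; apply: leq_trans xw wq'.
rewrite xq mul1r psel_rec_new // => S cS.
apply: good_accept G cS => //; last by rewrite tw wq'.
  by rewrite half_gt0.
by rewrite -[leqRHS](odd_double_half k') leq_addl.
Qed.

End Blocks.

(** * Blocks of equal length *)

Lemma card_ord_ltn n t : #|[set s : 'I_n | (s < t)%N]| = minn t n.
Proof.
rewrite cardE /enum_mem size_filter -enumT /=.
rewrite (@eq_count _ _ (preim val (fun i => i < t)%N)); last first.
  by move=> s; rewrite /= inE.
rewrite -count_map val_enum_ord.
elim: n => [|a IH]; first by rewrite minn0.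
rewrite -addn1 iotaD count_cat IH /=; lia.
Qed.

(** Divisibility makes the floor and the ceiling of [n / q] agree, so the first [c] blocks hold
    exactly [c * (n %/ q)] times; by monotonicity these form an initial segment. *)
Lemma consecutive_blocks_ltn n q (blk : 'I_n -> 'I_q) :
  (0 < q)%N -> (q %| n)%N -> consecutive_blocks blk ->
  forall (t : 'I_n) c, (c <= q)%N -> (t < c * (n %/ q))%N = (blk t < c)%N.
Proof.
move=> q0 qn [mono sz]; set g := (n %/ q)%N.
have ceil : ((n + q.-1) %/ q)%N = g.
  rewrite -(divnK qn) -/g divnMDl // divn_small ?addn0 //; lia.
have cD c : (c <= q)%N -> #|[set t | (blk t < c)%N]| = (c * g)%N.
  elim: c => [|c IH] cq.
    by rewrite mul0n; apply: eq_card0 => t; rewrite !inE.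
  have -> : [set t | (blk t < c.+1)%N] =
      [set t | (blk t < c)%N] :|: [set t | blk t == Ordinal cq].
    by apply/setP => t; rewrite !inE ltnS leq_eqVlt orbC -val_eqE.
  rewrite cardsU disjoint_setI0 ?cards0 ?subn0; last first.
    rewrite -setI_eq0; apply/eqP/setP => t; rewrite !inE -val_eqE /=; lia.
  rewrite IH; last by lia.
  have := sz (Ordinal cq); rewrite ceil -eqn_leq => /eqP <-.
  by rewrite mulSn addnC.
move=> t c cq; apply/idP/idP => tc; last first.
  rewrite -cD //; apply: (@leq_trans (minn t.+1 n)); first by case: t tc => /=; lia.
  rewrite -card_ord_ltn; apply/subset_leq_card/fintype.subsetP => s.
  by rewrite !inE ltnS => /mono st; apply: leq_ltn_trans st tc.
rewrite ltnNge; apply/negP => ct; move: tc; rewrite ltnNge => /negP; apply.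
rewrite -cD //; apply: (@leq_trans (minn t n)); last by lia.
rewrite -card_ord_ltn; apply/subset_leq_card/fintype.subsetP => s.
rewrite !inE => sc; rewrite ltnNge; apply/negP => /mono ts; lia.
Qed.

(** * Lowering the order of block marginals *)

Section Marginals.
Variables (R : realType) (n q : nat) (blk : 'I_n -> 'I_q) (mu : 'S_n -> R).
Variable delta : R.

(** The block map is fixed, so that marginals of different orders refer to the same blocks. *)
Definition block_marginal p : Prop :=
  forall (x : 'I_p -> 'I_n) (b : 'I_p -> 'I_q), injective x ->
    (1 - delta) * q%:R ^- p
      <= prob mu (fun pi => [forall i, blk (pi (x i)) == b i]).

Hypothesis q0 : (0 < q)%N.

(** A further item [z] exists since [p < n], and it lies in exactly one of the [q] blocks. Summing
    the bound of order [p.+1] over that block gains the missing factor [q]. *)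
Lemma block_marginal_pred p : (p < n)%N ->
  block_marginal p.+1 -> block_marginal p.
Proof.
move=> pn H x b ix.
have [z zx] : exists z, z \notin codom x.
  apply/existsP; rewrite -negb_forall; apply/negP => /forallP all.
  have : (#|'I_n| <= #|codom x|)%N by apply/subset_leq_card/fintype.subsetP.
  by rewrite card_codom // !card_ord leqNgt pn.
pose x' (i : 'I_p.+1) := oapp x z (unlift ord_max i).
have ix' : injective x'.
  move=> i j; rewrite /x'.
  case: unliftP => [i' ->|->]; case: unliftP => [j' ->|->] //=.
  - by move/ix ->.
  - by move=> e; case/negP: zx; rewrite -e codom_f.
  - by move=> e; case/negP: zx; rewrite e codom_f.
pose b' c (i : 'I_p.+1) := oapp b c (unlift ord_max i).
have -> : prob mu (fun pi => [forall i, blk (pi (x i)) == b i]) =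
    \sum_c prob mu (fun pi => [forall i, blk (pi (x' i)) == b' c i]).
  rewrite /prob; under [RHS]eq_bigr do rewrite big_mkcond.
  rewrite exchange_big [LHS]big_mkcond /=; apply: eq_bigr => pi _.
  have e c : [forall i, blk (pi (x' i)) == b' c i] =
      [forall i, blk (pi (x i)) == b i] && (c == blk (pi z)).
    apply/forallP/andP => [all|[/forallP all /eqP ->] i].
      split; last by have := all ord_max; rewrite /x' /b' unlift_none /= eq_sym.
      by apply/forallP => i; have := all (lift ord_max i); rewrite /x' /b' liftK.
    by rewrite /x' /b'; case: unliftP => [j _|_] /=; rewrite ?eqxx ?all.
  under eq_bigr do rewrite e.
  case: [forall i, _] => /=; last by rewrite big1.
  by rewrite -big_mkcond big_pred1_eq.
have q0R : q%:R != 0 :> R by rewrite pnatr_eq0 -lt0n.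
have -> : (1 - delta) * q%:R ^- p =
    \sum_(c < q) (1 - delta) * q%:R ^- p.+1.
  by rewrite sumr_const card_ord -[RHS]mulr_natl exprS invfM mulrCA mulVKf.
by apply: ler_sum => c _; apply: H.
Qed.

Lemma block_marginal_le p p' : (p' <= p)%N -> (p <= n)%N ->
  block_marginal p -> block_marginal p'.
Proof.
elim: p => [|p IH]; first by rewrite leqn0 => /eqP ->.
rewrite leq_eqVlt => /orP[/eqP->//|pp] pn /block_marginal_pred H.
by apply: IH; [|exact: ltnW|exact: H].
Qed.

End Marginals.

(** * Second moments under block independence *)

Section Moments.
Variables (R : realType) (n q : nat) (blk : 'I_n -> 'I_q) (mu : 'S_n -> R).
Variable delta : R.
Hypothesis q0 : (0 < q)%N.
Hypothesis n3 : (3 <= n)%N.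
Hypothesis mu_distr : is_distr mu.
Hypothesis marg3 : block_marginal blk mu delta 3.

Let B (pi : 'S_n) x := blk (pi x).

Definition avg (f : 'I_q -> R) : R := q%:R^-1 * \sum_a f a.

Let qR : q%:R != 0 :> R.
Proof. by rewrite pnatr_eq0 -lt0n. Qed.

Lemma avg_cst c : avg (fun=> c) = c.
Proof. by rewrite /avg sumr_const card_ord -(mulr_natl c) mulKf. Qed.

Lemma avgMl c f : avg (fun a => c * f a) = c * avg f.
Proof. by rewrite /avg -mulr_sumr mulrCA. Qed.

Lemma avgMr c f : avg (fun a => f a * c) = avg f * c.
Proof. by rewrite /avg -mulr_suml mulrA. Qed.

Lemma avgB f g : avg (fun a => f a - g a) = avg f - avg g.
Proof. by rewrite /avg big_split /= sumrN mulrDr mulrN. Qed.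

Lemma eq_avg f g : f =1 g -> avg f = avg g.
Proof. by move=> fg; rewrite /avg; congr (_ * _); apply: eq_bigr. Qed.

Lemma sum_eq_pick (T : finType) (f : T -> R) (a : T) :
  \sum_b f b * (a == b)%:R = f a.
Proof.
rewrite (bigD1 a) //= eqxx mulr1 big1 ?addr0 // => b ba.
by rewrite eq_sym (negPf ba) mulr0.
Qed.

(** Block independence bounds probabilities from below only, so it transfers to nonnegative
    functions. Upper bounds are obtained later by inserting 1 minus the function of interest. *)
Lemma expect_block3 (F : 'I_q -> 'I_q -> 'I_q -> R) x y z :
  (forall a b c, 0 <= F a b c) -> x != y -> x != z -> y != z ->
  (1 - delta) * avg (fun a => avg (fun b => avg (F a b))) <=
    expect mu (fun pi => F (B pi x) (B pi y) (B pi z)).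
Proof.
move=> F0 xy xz yz.
have -> : expect mu (fun pi => F (B pi x) (B pi y) (B pi z)) =
    \sum_a \sum_b \sum_c F a b c *
      prob mu (fun pi => [&& B pi x == a, B pi y == b & B pi z == c]).
  transitivity (\sum_a \sum_b \sum_c \sum_pi F a b c *
      (mu pi * ((B pi x == a)%:R * (B pi y == b)%:R * (B pi z == c)%:R))).
    rewrite /expect.
    under [RHS]eq_bigr => a _.
      under eq_bigr do rewrite exchange_big /=.
      rewrite exchange_big /=.
      over.
    rewrite exchange_big /=; apply: eq_bigr => pi _.
    rewrite -(sum_eq_pick (fun a => F a (B pi y) (B pi z)) (B pi x)) mulr_sumr.
    apply: eq_bigr => a _.
    rewrite -(sum_eq_pick (fun b => F a b (B pi z)) (B pi y)) mulr_suml mulr_sumr.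
    apply: eq_bigr => b _.
    rewrite -(sum_eq_pick (F a b) (B pi z)) !mulr_suml mulr_sumr.
    by apply: eq_bigr => c _; ring.
  apply: eq_bigr => a _; apply: eq_bigr => b _; apply: eq_bigr => c _.
  rewrite probE -mulr_sumr; congr (_ * _); apply: eq_bigr => pi _.
  by rewrite -!natrM !mulnb andbA.
rewrite /avg.
have -> : q%:R^-1 * \sum_a q%:R^-1 * (\sum_b q%:R^-1 * \sum_c F a b c) =
    q%:R ^- 3 * \sum_a \sum_b \sum_c F a b c :> R.
  under eq_bigr do rewrite -mulr_sumr.
  by rewrite -!mulr_sumr -exprVn !exprS expr0; ring.
rewrite mulrA !mulr_sumr; apply: ler_sum => a _.
rewrite !mulr_sumr; apply: ler_sum => b _.
rewrite !mulr_sumr; apply: ler_sum => c _.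
rewrite mulrC ler_wpM2l //.
pose X := nth x [:: x; y; z]; pose Y := nth a [:: a; b; c].
apply: le_trans (_ : prob mu (fun pi => [forall i : 'I_3, blk (pi (X i)) == Y i]) <= _).
  apply: marg3 => i j /eqP; rewrite /X nth_uniq ?ltn_ord //=.
    by move/eqP/val_inj.
  by rewrite !inE !negb_or xy xz yz.
rewrite !probE; apply: ler_sum => pi _; rewrite ler_wpM2l ?mu_distr.1 // ler_nat.
case: forallP => //= all.
have := all (@Ordinal 3 0 isT); have := all (@Ordinal 3 1 isT).
by have := all (@Ordinal 3 2 isT); rewrite /X /Y /B /= => -> -> ->.
Qed.

(** Supplies the dummy items through which bounds of order two and one are read off from order
    three. *)
Lemma exists_other (x y : 'I_n) : exists z, (x != z) && (y != z).
Proof.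
have : (0 < #|~: [set x; y]|)%N.
  rewrite cardsCs finset.setCK cards2 card_ord; case: (_ != _); lia.
case/card_gt0P => z; rewrite !inE negb_or => /andP[zx zy].
by exists z; rewrite eq_sym zx eq_sym zy.
Qed.

Lemma expect_block2 (F : 'I_q -> 'I_q -> R) x y :
  (forall a b, 0 <= F a b) -> x != y ->
  (1 - delta) * avg (fun a => avg (F a)) <=
    expect mu (fun pi => F (B pi x) (B pi y)).
Proof.
move=> F0 xy; have [z /andP[xz yz]] := exists_other x y.
have := @expect_block3 (fun a b _ => F a b) _ _ _ (fun a b _ => F0 a b) xy xz yz.
apply: le_trans; rewrite le_eqVlt; apply/orP; left; apply/eqP; congr (_ * _).
by apply: eq_avg => a; apply: eq_avg => b; rewrite avg_cst.
Qed.

Lemma expect_block1 (f : 'I_q -> R) x : (forall a, 0 <= f a) ->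
  (1 - delta) * avg f <= expect mu (fun pi => f (B pi x)).
Proof.
move=> f0; have [y /andP[xy _]] := exists_other x x.
have := @expect_block2 (fun a _ => f a) _ _ (fun a _ => f0 a) xy.
apply: le_trans; rewrite le_eqVlt; apply/orP; left; apply/eqP; congr (_ * _).
by apply: eq_avg => a; rewrite avg_cst.
Qed.

Lemma expect_cst c : expect mu (fun=> c) = c.
Proof. by rewrite /expect -mulr_suml mu_distr.2 mul1r. Qed.

Lemma expectB f g :
  expect mu (fun pi => f pi - g pi) = expect mu f - expect mu g.
Proof.
rewrite /expect -sumrB; apply: eq_bigr => pi _; ring.
Qed.

Lemma block_delta_ge0 : 0 <= delta.
Proof.
pose x := Ordinal n3.
have := @expect_block1 (fun=> 1) x (fun=> ler01).
by rewrite avg_cst expect_cst mulr1; lra.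
Qed.

(** The square is expanded into pairs, and each pair is bounded above through [1 - f * g * g >= 0]
    at a cost of at most [delta]. For independent uniform blocks, pairs of distinct items contribute
    0 because [avg g = 0]; the diagonal gives the variance term. *)
Lemma expect_sqsum_le (f g : 'I_q -> R) x (Y : {set 'I_n}) :
  x \notin Y -> (forall a, 0 <= f a <= 1) -> (forall a, -1 <= g a <= 1) ->
  avg g = 0 ->
  expect mu (fun pi => f (B pi x) * (\sum_(y in Y) g (B pi y)) ^+ 2) <=
    #|Y|%:R * (avg f * avg (fun a => g a ^+ 2)) + delta * #|Y|%:R ^+ 2.
Proof.
move=> xY f01 g11 ag.
have d0 := block_delta_ge0.
have -> : expect mu (fun pi => f (B pi x) * (\sum_(y in Y) g (B pi y)) ^+ 2) =
   \sum_(y in Y) \sum_(z in Y)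
     expect mu (fun pi => f (B pi x) * g (B pi y) * g (B pi z)).
  rewrite /expect; under [RHS]eq_bigr do rewrite exchange_big /=.
  rewrite exchange_big /=; apply: eq_bigr => pi _.
  rewrite expr2 mulr_suml !mulr_sumr; apply: eq_bigr => y _.
  by rewrite !mulr_sumr; apply: eq_bigr => z _; rewrite !mulrA.
have cY (c : R) : \sum_(y in Y) c = #|Y|%:R * c.
  by rewrite sumr_const mulr_natl.
have -> : #|Y|%:R * (avg f * avg (fun a => g a ^+ 2)) + delta * #|Y|%:R ^+ 2 =
    \sum_(y in Y) (avg f * avg (fun a => g a ^+ 2) + \sum_(z in Y) delta).
  by rewrite !cY; ring.
apply: ler_sum => y yY; rewrite (bigD1 y yY) [X in _ <= _ + X](bigD1 y yY) /= addrA.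
have xy : x != y by apply: contraNneq xY => ->.
apply: lerD.
  have := @expect_block2 (fun a b => 1 - f a * g b ^+ 2) x y _ xy.
  rewrite expectB expect_cst.
  have -> : avg (fun a => avg (fun b => 1 - f a * g b ^+ 2)) =
      1 - avg f * avg (fun a => g a ^+ 2).
    rewrite (@eq_avg _ (fun a => 1 - f a * avg (fun a => g a ^+ 2))).
      by rewrite avgB avg_cst avgMr.
    by move=> a; rewrite avgB avg_cst avgMl.
  have -> : expect mu (fun pi => f (B pi x) * g (B pi y) ^+ 2) =
      expect mu (fun pi => f (B pi x) * g (B pi y) * g (B pi y)).
    by apply: eq_bigr => pi _; rewrite expr2 (mulrA (f _)).
  have p0 : 0 <= avg f * avg (fun a => g a ^+ 2).
    rewrite mulr_ge0 // mulr_ge0 ?invr_ge0 ?ler0n // sumr_ge0 // => a _.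
      by case/andP: (f01 a).
    by rewrite sqr_ge0.
  have e a b : 0 <= 1 - f a * g b ^+ 2.
    by have := f01 a; have := g11 b; nra.
  move=> /(_ e) H; nra.
apply: ler_sum => z /andP[zY zy].
have xz : x != z by apply: contraNneq xY => ->.
have yz : y != z by rewrite eq_sym.
have := @expect_block3 (fun a b c => 1 - f a * g b * g c) x y z _ xy xz yz.
rewrite expectB expect_cst.
have -> : avg (fun a => avg (fun b => avg (fun c => 1 - f a * g b * g c))) = 1.
  rewrite (@eq_avg _ (fun=> 1)) ?avg_cst // => a.
  rewrite (@eq_avg _ (fun=> 1)) ?avg_cst // => b.
  by rewrite avgB avg_cst avgMl ag mulr0 subr0.
have e a b c : 0 <= 1 - f a * g b * g c.
  have := f01 a; have := g11 b; have := g11 c => /andP[? ?] /andP[? ?] /andP[? ?].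
  have : -1 <= g b * g c <= 1 by apply/andP; split; nra.
  by case/andP => ? ?; rewrite -mulrA; nra.
by move=> /(_ e); lra.
Qed.

Definition frac (I : pred 'I_q) : R := avg (fun a => (I a)%:R).

Lemma frac_ge0 I : 0 <= frac I.
Proof. by rewrite mulr_ge0 ?invr_ge0 // sumr_ge0. Qed.

Lemma frac_le1 I : frac I <= 1.
Proof.
rewrite -[leRHS](avg_cst 1) ler_wpM2l ?invr_ge0 //.
by apply: ler_sum => a _; case: (I a).
Qed.

Lemma prob_block_ge (I : pred 'I_q) x :
  frac I - delta <= prob mu (fun pi => I (B pi x)).
Proof.
have := @expect_block1 (fun a => (I a)%:R) x (fun _ => ler0n _ _).
rewrite probE /expect -/(frac I); have := frac_le1 I; have := block_delta_ge0.
nra.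
Qed.

(** Chebyshev's inequality weighted by the indicator that [x] falls in [J]. Keeping this event in
    the bound scales the variance term by [frac J], which stands in for conditioning on the block of
    [x]. *)
Lemma prob_count_dev (I J : pred 'I_q) x (Y : {set 'I_n}) (D : R) :
  x \notin Y -> 0 < D ->
  prob mu (fun pi => J (B pi x) &&
     (D <= `|#|[set y in Y | I (B pi y)]|%:R - #|Y|%:R * frac I|)) <=
   (#|Y|%:R * (frac J * frac I) + delta * #|Y|%:R ^+ 2) / D ^+ 2.
Proof.
move=> xY D0; rewrite ler_pdivlMr ?exprn_gt0 //.
pose g a : R := (I a)%:R - frac I.
have ag : avg g = 0 by rewrite avgB avg_cst subrr.
have fI0 := frac_ge0 I; have fI1 := frac_le1 I.
have g11 a : -1 <= g a <= 1.
  by rewrite /g; case: (I a) => /=; apply/andP; split; lra.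
have f01 a : 0 <= ((J a)%:R : R) <= 1 by case: (J a); rewrite /= ?lexx ?ler01.
(* [g] is a centred indicator, with variance [frac I - frac I ^ 2]. *)
have ag2 : avg (fun a => g a ^+ 2) <= frac I.
  have -> : avg (fun a => g a ^+ 2) = frac I - frac I ^+ 2.
    rewrite (@eq_avg _ (fun a => (I a)%:R - (frac I * ((I a)%:R + g a)))).
      rewrite avgB avgMl; congr (_ - _); rewrite expr2; congr (_ * _).
      rewrite (@eq_avg _ (fun a => (I a)%:R - (- g a))) ?avgB; last first.
        by move=> a; rewrite opprK.
      rewrite (@eq_avg (fun a => - g a) (fun a => -1 * g a)); last first.
        by move=> a; rewrite mulN1r.
      by rewrite avgMl ag mulr0 subr0.
    by move=> a; rewrite /g; case: (I a) => /=; ring.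
  by rewrite lerBlDr lerDl sqr_ge0.
apply: le_trans (le_trans (expect_sqsum_le xY f01 g11 ag) _); last first.
  by rewrite lerD2r ler_wpM2l // ler_wpM2l // frac_ge0.
rewrite probE mulr_suml; apply: ler_sum => pi _.
rewrite -mulrA ler_wpM2l ?mu_distr.1 //.
have -> : \sum_(y in Y) g (B pi y) =
    #|[set y in Y | I (B pi y)]|%:R - #|Y|%:R * frac I.
  rewrite /g sumrB sumr_const -(mulr_natl (frac I)); congr (_ - _).
  rewrite -sum1_card natr_sum big_mkcond [RHS]big_mkcond /=.
  by apply: eq_bigr => y _; rewrite !inE; case: (y \in Y); case: (I _).
case: (J _) => /=; last by rewrite !mul0r.
case: (leP D) => DD; last by rewrite mul0r mul1r sqr_ge0.
rewrite !mul1r -[leRHS]real_normK ?num_real // lerXn2r ?nnegrE //.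
exact: ltW.
Qed.

End Moments.

Lemma frac_ltn (R : realType) q t : (t <= q)%N ->
  frac R (fun a : 'I_q => (a < t)%N) = t%:R / q%:R.
Proof.
move=> tq; rewrite /frac /avg -natr_sum.
have -> : (\sum_(a < q) (a < t))%N = #|[set a : 'I_q | (a < t)%N]|.
  rewrite -sum1_card [RHS]big_mkcond; apply: eq_bigr => a _.
  by rewrite inE; case: ltnP.
by rewrite card_ord_ltn (minn_idPl tq) mulrC.
Qed.

Lemma frac_interval (R : realType) q t w : (t + w <= q)%N ->
  frac R (fun a : 'I_q => (t <= a < t + w)%N) = w%:R / q%:R.
Proof.
move=> tq; rewrite [RHS](_ : _ = frac R (fun a : 'I_q => (a < t + w)%N) -
    frac R (fun a : 'I_q => (a < t)%N)).
  rewrite /frac -avgB; apply: eq_avg => a.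
  case: (ltnP a t) => at_; case: (ltnP a (t + w)) => //= atw;
    rewrite ?subrr ?subr0 //.
  by have := leq_trans at_ (leq_trans (leq_addr w t) atw); rewrite ltnn.
rewrite !frac_ltn //; last by lia.
by rewrite natrD mulrDl addrAC subrr add0r.
Qed.

(** * Expected value of one phase *)

Section PhaseValue.
Variables (R : realType) (n q k : nat) (v : 'I_n -> R).
Variables (blk : 'I_n -> 'I_q) (mu : 'S_n -> R) (delta : R).
Hypothesis q0 : (0 < q)%N.
Hypothesis n3 : (3 <= n)%N.
Hypothesis mu_distr : is_distr mu.
Hypothesis marg3 : block_marginal blk mu delta 3.
Hypothesis k0 : (0 < k)%N.
Hypothesis kn : (k <= n)%N.
Hypothesis kq : (k <= q)%N.
Hypothesis v0 : forall x, 0 <= v x.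

(** [lam] is the ideal fraction of blocks before the threshold, [2 * lam] that of the whole level,
    and [h] is the integer part of [k * lam]. *)
Variables (h t q' : nat) (lam ep : R).
Hypothesis lam1 : lam <= 1.
Hypothesis klam : 1 <= k%:R * lam.
Hypothesis h_le : h%:R <= k%:R * lam.
Hypothesis h_gt : k%:R * lam < h%:R + 1.
Hypothesis tq' : (t <= q')%N.
Hypothesis q'q : (q' <= q)%N.
Hypothesis q'_near : `|q'%:R / q%:R - 2 * lam| <= k%:R^-1.
Hypothesis t_near : `|t%:R / q%:R - lam| <= k%:R^-1.
Hypothesis ep0 : 0 < ep.
Hypothesis small_delta : 9 * k%:R * delta <= lam ^+ 2.

(** The factor [1 - 4 * ep] keeps the mean number of competitors in the window, about
    [(1 + ep) * (1 - 4 * ep) * k * lam], well below [h]. *)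
Definition window : nat := Num.truncn ((1 - 4 * ep) * lam * q%:R).
Definition rank_cut : nat := (Num.truncn ((1 + ep) * k%:R)).+1.

Local Notation K := (k%:R).
Local Notation W := window.
Local Notation r := rank_cut.
Local Notation s := (t%:R / q%:R).
Local Notation u := (window%:R / q%:R).

Section MainCase.
Hypothesis ep_small : 4 * ep <= 1.
Hypothesis ep_large : 16 <= ep * (K * lam).

Let K1 : 1 <= K :> R. Proof. by rewrite ler1n. Qed.
Let Q0 : 0 < q%:R :> R. Proof. by rewrite ltr0n. Qed.
Let lam0 : 0 < lam. Proof. by have := klam; have := K1; nra. Qed.
Let d0 : 0 <= delta. Proof. exact: block_delta_ge0 q0 n3 mu_distr marg3. Qed.

Let KsE : K * lam - 1 <= K * s <= K * lam + 1.
Proof.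
move: t_near; rewrite ler_norml => /andP[a b].
have KK : K * K^-1 = 1 :> R by rewrite divff // pnatr_eq0 -lt0n.
apply/andP; split; have := K1; nra.
Qed.

Let s01 : (0 <= s :> R) && (s <= 1 :> R).
Proof.
rewrite divr_ge0 //= ler_pdivrMr // mul1r ler_nat; exact: leq_trans q'q.
Qed.

Let uE : (1 - 4 * ep) * lam - q%:R^-1 < u <= (1 - 4 * ep) * lam.
Proof.
have a0 : 0 <= (1 - 4 * ep) * lam * q%:R by rewrite !mulr_ge0 ?(ltW lam0) //; have := ep_small; lra.
have /andP[a b] := truncn_itv a0.
rewrite ler_pdivrMr // a andbT ltr_pdivlMr // mulrBl mulVf ?lt0r_neq0 //.
by rewrite ltrBlDr natr1.
Qed.

Let u0 : 0 <= u :> R. Proof. by rewrite divr_ge0. Qed.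

(** The [4 * ep * lam] saved by shortening the window exceeds [2 / k], the joint error of [t] and
    [q'], because [ep_large] gives [16 / k <= ep * lam]. *)
Lemma window_le : (t + W <= q')%N.
Proof.
rewrite -(ler_nat R) -(ler_pM2r (_ : 0 < q%:R^-1)) ?invr_gt0 //.
rewrite natrD mulrDl.
move: q'_near; rewrite ler_norml => /andP[a _].
move: t_near; rewrite ler_norml => /andP[_ b].
have /andP[_ c] := uE.
have KK : K * K^-1 = 1 :> R by rewrite divff // pnatr_eq0 -lt0n.
have Ke : K^-1 <= ep * lam by have := K1; have := ep_large; nra.
have Ki : 0 <= K^-1 :> R by rewrite invr_ge0.
nra.
Qed.

Let rE : (1 + ep) * K < r%:R <= (1 + ep) * K + 1.
Proof.
have a0 : 0 <= (1 + ep) * K by rewrite mulr_ge0 //; have := ep0; lra.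
have /andP[a b] := truncn_itv a0.
by rewrite b /r -natr1 lerD2r a.
Qed.

Let D : R := ep * (K * lam) / 2.
Let D0 : 0 < D. Proof. by rewrite divr_gt0 //; have := ep_large; lra. Qed.

(** The constant is [4 * (6 + 1)]: with [m <= 3 * k], [u <= lam] and [a <= 2 * lam] the main term is
    at most [6 * k * lam ^ 2], [small_delta] bounds the other by [k * lam ^ 2], and
    [D ^ 2 = (ep * k * lam) ^ 2 / 4]. *)
Let dev_le (a : R) (m : nat) : 0 <= a -> a <= 2 * lam -> (m <= r)%N ->
  (m%:R * (u * a) + delta * m%:R ^+ 2) / D ^+ 2 <= 28 / (ep ^+ 2 * K).
Proof.
move=> a0 a2 mr.
have m3 : m%:R <= 3 * K :> R.
  have : m%:R <= r%:R :> R by rewrite ler_nat.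
  have /andP[_ b] := rE; have := K1; have := ep_small; nra.
have m0 : 0 <= m%:R :> R by [].
rewrite ler_pdivrMr ?exprn_gt0 //.
have -> : 28 / (ep ^+ 2 * K) * D ^+ 2 = 7 * (K * lam ^+ 2).
  rewrite /D; field; rewrite pnatr_eq0 -lt0n k0 lt0r_neq0 //.
have ul : u * a <= lam * (2 * lam).
  have /andP[_ b] := uE; apply: ler_pM => //; have := lam0; have := ep0; nra.
have : m%:R * (u * a) <= 6 * (K * lam ^+ 2).
  apply: le_trans (_ : (3 * K) * (lam * (2 * lam)) <= _); last by nra.
  by apply: ler_pM => //; rewrite mulr_ge0.
have : delta * m%:R ^+ 2 <= K * lam ^+ 2.
  apply: le_trans (_ : delta * (3 * K) ^+ 2 <= _).
    by rewrite ler_wpM2l // lerXn2r ?nnegrE //; have := K1; lra.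
  have := small_delta; have := K1; nra.
lra.
Qed.

Lemma prob_good_ge x : (rank v x)%:R <= (1 - ep) * K ->
  (1 - 5 * ep) * lam - 84 / (ep ^+ 2 * K) <=
    prob mu (fun pi => good v blk pi h r t (t + W) x).
Proof.
move=> rx.
pose I := fun a : 'I_q => (a < t)%N.
pose J := fun a : 'I_q => (t <= a < t + W)%N.
have twq := leq_trans window_le q'q.
have fI : frac R I = s by apply: frac_ltn; apply: leq_trans q'q.
have fJ : frac R J = u by apply: frac_interval.
pose Y1 := [set y | (rank v y < rank v x)%N].
pose Y := [set y | (rank v y < r)%N] :\ x.
have xY1 : x \notin Y1 by rewrite inE ltnn.
have xY : x \notin Y by rewrite !inE eqxx.
have cY1 : #|Y1| = rank v x.
  by rewrite card_rank_lt; apply/minn_idPl/ltnW/rank_ltn.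
have /andP[r1 r2] := rE; have /andP[u1 u2] := uE; have /andP[s1 s2] := KsE.
have /andP[s3 s4] := s01.
have cYr : (#|Y| <= r)%N.
  have := subset_leq_card (subsetDl [set y | (rank v y < r)%N] [set x]).
  rewrite card_rank_lt -/Y; move/leq_trans; apply; exact: geq_minl.
have rxr : (rank v x <= r)%N.
  by rewrite -(ler_nat R); apply: le_trans rx _; have := K1; have := ep0; nra.
pose dv (Z : {set 'I_n}) (A : pred 'I_q) (pi : 'S_n) := J (blk (pi x)) &&
     (D <= `|#|[set y in Z | A (blk (pi y))]|%:R - #|Z|%:R * frac R A|).
have P1 : prob mu (dv Y1 I) <= 28 / (ep ^+ 2 * K).
  apply: le_trans (prob_count_dev q0 n3 mu_distr marg3 _ _ xY1 D0) _.
  rewrite fI fJ; apply: dev_le; rewrite ?cY1 //.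
  by have := K1; have := klam; nra.
have P2 : prob mu (dv Y I) <= 28 / (ep ^+ 2 * K).
  apply: le_trans (prob_count_dev q0 n3 mu_distr marg3 _ _ xY D0) _.
  rewrite fI fJ; apply: dev_le => //.
  by have := K1; have := klam; nra.
have P3 : prob mu (dv Y J) <= 28 / (ep ^+ 2 * K).
  apply: le_trans (prob_count_dev q0 n3 mu_distr marg3 _ _ xY D0) _.
  by rewrite fJ; apply: dev_le => //; have := ep0; have := lam0; nra.
(* A failed clause of [good] puts its count at least [D] away from its mean: the mean differs from
   [h] by at least [ep * k * lam] up to bounded rounding terms, and [ep_large] lets half of this
   absorb them. *)
have dev1 (N : R) : h%:R <= N -> D <= `|N - #|Y1|%:R * s|.
  move=> hN; apply: le_trans (ler_norm _); rewrite cY1.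
  have : (rank v x)%:R * s <= (1 - ep) * K * s by rewrite ler_wpM2r.
  by rewrite /D; have := ep_large; have := h_gt; have := ep0; have := ep_small; nra.
have dev2 (N : R) : (r < n)%N -> N <= h%:R -> D <= `|N - #|Y|%:R * s|.
  move=> nr hN; rewrite distrC; apply: le_trans (ler_norm _).
  have cY : (1 + ep) * K - 1 <= #|Y|%:R.
    have : (r <= #|Y|.+1)%N.
      have := cardsD1 x [set y | (rank v y < r)%N].
      rewrite card_rank_lt -/Y (minn_idPl (ltnW nr)) => e.
      by rewrite [leqLHS]e; case: (x \in _); rewrite ?add1n ?add0n.
    by rewrite -(ler_nat R) -natr1; lra.
  have : ((1 + ep) * K - 1) * s <= #|Y|%:R * s by rewrite ler_wpM2r.
  by rewrite /D; have := ep_large; have := h_le; have := ep0; have := ep_small; nra.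
have dev3 (N : R) : h%:R <= N -> D <= `|N - #|Y|%:R * u|.
  move=> hN; apply: le_trans (ler_norm _).
  have : #|Y|%:R * u <= ((1 + ep) * K + 1) * ((1 - 4 * ep) * lam).
    by apply: ler_pM => //; apply: le_trans r2; rewrite ler_nat.
  rewrite /D; have := ep_large; have := h_gt; have := ep0; have := ep_small.
  have := lam0; have := lam1; nra.
have PJ := prob_block_ge q0 n3 mu_distr marg3 J x.
(* Union bound: an item landing in the window is good unless one of the three counts deviates. Hence
   [84 = 3 * 28]. *)
have cover : prob mu (fun pi => J (blk (pi x))) <=
    prob mu (fun pi => good v blk pi h r t (t + W) x) +
    (prob mu (dv Y1 I) + (prob mu (dv Y I) + prob mu (dv Y J))).
  rewrite !probE -!big_split /=; apply: ler_sum => pi _.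
  rewrite -!mulrDr ler_wpM2l ?mu_distr.1 // -!natrD ler_nat.
  case Jx : (J _) => //; rewrite /dv Jx /=.
  suff : [|| good v blk pi h r t (t + W) x,
    D <= `|#|[set y in Y1 | I (blk (pi y))]|%:R - #|Y1|%:R * frac R I|,
    D <= `|#|[set y in Y | I (blk (pi y))]|%:R - #|Y|%:R * frac R I| |
    D <= `|#|[set y in Y | J (blk (pi y))]|%:R - #|Y|%:R * frac R J|].
    by do 3![case/orP => [->|]; rewrite ?addnA ?leq_addl ?addn1 ?leq_addr //];
      move=> ->; rewrite ?addnA ?leq_addl ?addn1.
  rewrite /good; move: Jx; rewrite {1}/J => -> /=.
  have -> : [set y | (rank v y < rank v x)%N && (blk (pi y) < t)%N] =
    [set y in Y1 | I (blk (pi y))] by apply/setP => y; rewrite !inE.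
  rewrite -/Y fI fJ.
  case: ltnP => [_|c1] /=; last by rewrite dev1 ?ler_nat.
  case: ltnP => [_|c3] /=; last by rewrite dev3 ?ler_nat ?orbT.
  case: (leqP n r) => //= nr; case: leqP => //= c2.
  by rewrite (dev2 _ nr) ?orbT // ler_nat ltnW.
(* Truncating the window costs [1 / q] and the marginal of [x] costs [delta]. Both are at most
   [1 / k <= ep * lam / 16], so the coefficient 4 of [ep] becomes at most 5. *)
have qi : q%:R^-1 <= K^-1 :> R.
  by rewrite lef_pV2 ?posrE ?ler_nat // ltr0n.
have KK : K * K^-1 = 1 :> R by rewrite divff // pnatr_eq0 -lt0n.
have Ke : 16 * K^-1 <= ep * lam by have := K1; have := ep_large; nra.
have dK : delta <= K^-1.
  rewrite -(ler_pM2l (lt_le_trans ltr01 K1)) KK.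
  have l2 : lam ^+ 2 <= 1 by rewrite exprn_ile1 // ltW.
  by have := small_delta; have := d0; have := K1; nra.
have -> : 84 / (ep ^+ 2 * K) = 3 * (28 / (ep ^+ 2 * K)).
  by rewrite mulrA; congr (_ / _); ring.
rewrite fJ in PJ; lra.
Qed.

End MainCase.

(** By averaging, the ranks up to [(1 - ep) * k] carry at least a fraction [1 - ep] of the top
    value, which turns the 5 into 6. If [4 * ep > 1] or [ep * k * lam < 16], the left side is
    nonpositive. *)
Lemma phase_value_ge :
  ((1 - 6 * ep) * lam - 84 / (ep ^+ 2 * K)) * \sum_(x | (rank v x < k)%N) v x <=
  \sum_x v x * prob mu (fun pi => good v blk pi h r t (minn q' (t + W)) x).
Proof.
have K0 : 0 < K :> R by rewrite ltr0n.
have lam0 : 0 < lam by have := klam; nra.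
have := ep0; have := lam1 => lam1' ep0'.
have e2K : 0 < ep ^+ 2 * K by rewrite mulr_gt0 ?exprn_gt0.
have c0 : 0 <= 84 / (ep ^+ 2 * K) by rewrite divr_ge0 // ltW.
have V0 : 0 <= \sum_(x | (rank v x < k)%N) v x by apply: sumr_ge0.
have P0 (E : pred 'S_n) : 0 <= prob mu E.
  by apply: sumr_ge0 => pi _; apply: mu_distr.1.
have T0 : 0 <= \sum_x v x * prob mu (fun pi => good v blk pi h r t (minn q' (t + W)) x).
  by apply: sumr_ge0 => x _; rewrite mulr_ge0.
have triv c : c <= 0 -> c * \sum_(x | (rank v x < k)%N) v x <=
  \sum_x v x * prob mu (fun pi => good v blk pi h r t (minn q' (t + W)) x).
  by move=> cn; apply: le_trans T0; rewrite mulr_le0_ge0.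
case: (leP (4 * ep) 1) => ep4; last by apply: triv; nra.
case: (leP 16 (ep * (K * lam))) => epl; last first.
  apply: triv; rewrite subr_le0; apply: le_trans (_ : lam <= _); first by nra.
  by rewrite ler_pdivlMr //; nra.
set c := (1 - 5 * ep) * lam - 84 / (ep ^+ 2 * K).
case: (leP 0 c) => cp; last by apply: triv; move: cp; rewrite /c; nra.
have -> : minn q' (t + W) = (t + W)%N by apply/minn_idPr/window_le.
(* Ranks start at 0, so [rank v x < l] means rank at most [(1 - ep) * k], while [l] itself exceeds
   [(1 - ep) * k]. *)
pose l := (Num.truncn ((1 - ep) * K)).+1.
have a0 : 0 <= (1 - ep) * K by rewrite mulr_ge0 //; lra.
have /andP[l1 l2] := truncn_itv a0.
have lk : (l <= k)%N by rewrite -(ltr_nat R); apply: le_lt_trans l1 _; nra.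
have Vl : (1 - ep) * \sum_(x | (rank v x < k)%N) v x <=
    \sum_(x | (rank v x < l)%N) v x.
  rewrite -(ler_pM2l K0); apply: le_trans (sum_top_average v lk kn).
  by rewrite mulrA ler_wpM2r // mulrC ltW.
apply: le_trans (_ : c * \sum_(x | (rank v x < l)%N) v x <= _).
  apply: le_trans (_ : c * ((1 - ep) * \sum_(x | (rank v x < k)%N) v x) <= _).
    by rewrite mulrA ler_wpM2r //; rewrite /c; nra.
  by rewrite ler_wpM2l.
rewrite mulr_sumr big_mkcond /=; apply: ler_sum => x _.
case: ifP => xl; last by rewrite mulr_ge0.
rewrite mulrC ler_wpM2l //; apply: prob_good_ge => //.
by apply: le_trans l1; rewrite ler_nat -ltnS.
Qed.

End PhaseValue.

(** * Recursion over the levels *)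

Section Levels.
Variables (R : realType) (n q k g : nat) (v : 'I_n -> R).
Variables (blk : 'I_n -> 'I_q) (mu : 'S_n -> R) (delta kap : R).
Hypothesis blkE : forall (t : 'I_n) c, (c <= q)%N -> (t < c * g)%N = (blk t < c)%N.
Hypothesis mu_distr : is_distr mu.
Hypothesis marg3 : block_marginal blk mu delta 3.
Hypothesis k3 : (3 <= k)%N.
Hypothesis kn : (k <= n)%N.
Hypothesis k4q : (k ^ 4 <= q)%N.
Hypothesis v0 : forall x, 0 <= v x.
Hypothesis small_delta : 9 * k%:R ^+ 3 * delta <= 1.
Hypothesis kap0 : 0 < kap.
Hypothesis kap3 : kap ^+ 3 * k%:R = 1.

Let k0 : (0 < k)%N. Proof. exact: leq_trans k3. Qed.

Let q0 : (0 < q)%N. Proof. by apply: leq_trans k4q; rewrite expn_gt0 k0. Qed.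

Definition level_value j q' : R :=
  \sum_x v x * expect mu (fun pi => sel v g blk pi (k %/ 2 ^ j) q' x).

Definition top_value : R := \sum_(x | (rank v x < k)%N) v x.

(** The tolerance [1 / k] reproduces itself: passing to [t] near [q' / 2] halves the inherited
    error, and a deviation of at most [q / k] of [2 * t] from [q'] adds the other half. *)
Definition near_level j q' : bool :=
  `|q'%:R / q%:R - 2^-1 ^+ j| <= (k%:R^-1 : R).

(* [6 ep lam + 84 / (ep^2 k)] at [lam = 2^-(j+1)] and [ep = kap (3/2)^j] is at
   most [87 kap (3/4)^j]; any ratio strictly between 1 and 2 instead of 3/2
   makes both kinds of loss summable over the levels. *)
Definition level_gain j : R := 2^-1 ^+ j.+1 - 87 * kap * (3 / 4) ^+ j.

Lemma level_value_ge0 j q' : 0 <= level_value j q'.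
Proof.
apply: sumr_ge0 => x _; rewrite mulr_ge0 //; apply: sumr_ge0 => pi _.
by rewrite mulr_ge0 ?sel_ge0 ?mu_distr.1.
Qed.

Lemma top_value_ge0 : 0 <= top_value.
Proof. exact: sumr_ge0. Qed.

Lemma level_phase j t q' : (2 ^ j.+1 <= k)%N -> (t <= q' <= q)%N ->
  near_level j q' -> near_level j.+1 t ->
  level_gain j * top_value <=
  \sum_x v x * prob mu (fun pi => good v blk pi (k %/ 2 ^ j)./2
     (rank_cut k (kap * (3 / 2) ^+ j)) t
     (minn q' (t + window q (2^-1 ^+ j.+1) (kap * (3 / 2) ^+ j))) x).
Proof.
move=> jk /andP[tq' q'q] nq' nt.
set lam := 2^-1 ^+ j.+1; set ep := kap * (3 / 2) ^+ j.
have K0 : 0 < k%:R :> R by rewrite ltr0n.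
have P0 : 0 < 2 ^+ j.+1 :> R by rewrite exprn_gt0.
have lamE : lam = (2 ^+ j.+1)^-1 by rewrite /lam exprVn.
have lam0 : 0 < lam by rewrite lamE invr_gt0.
have lam1 : lam <= 1 by rewrite /lam exprn_ile1 //; lra.
have klam : 1 <= k%:R * lam.
  by rewrite lamE ler_pdivlMr // mul1r -natrX ler_nat.
have hE : (k %/ 2 ^ j)./2 = (k %/ 2 ^ j.+1)%N.
  by rewrite -divn2 -divnMA -expnSr.
have h_le : (k %/ 2 ^ j)./2%:R <= k%:R * lam.
  by rewrite lamE hE ler_pdivlMr // -natrX -natrM ler_nat leq_divM.
have h_gt : k%:R * lam < (k %/ 2 ^ j)./2%:R + 1.
  by rewrite lamE hE ltr_pdivrMr // natr1 -natrX -natrM ltr_nat ltn_ceil ?expn_gt0.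
have ep0 : 0 < ep by rewrite mulr_gt0 ?kap0 // exprn_gt0 // divr_gt0.
have kq : (k <= q)%N by apply: leq_trans k4q; rewrite -{1}(expn1 k) leq_pexp2l.
have sd : 9 * k%:R * delta <= lam ^+ 2.
  have Kl2 : 1 <= (k%:R * lam) ^+ 2 by rewrite exprn_ege1.
  have K2 : 0 < k%:R ^+ 2 :> R by rewrite exprn_gt0.
  rewrite -(ler_pM2l K2) -exprMn.
  apply: le_trans Kl2; apply: le_trans small_delta; rewrite le_eqVlt.
  by apply/orP; left; apply/eqP; ring.
have nq2 : `|q'%:R / q%:R - 2 * lam| <= k%:R^-1.
  move: nq'; rewrite /near_level.
  by have -> : 2^-1 ^+ j = 2 * lam :> R by rewrite /lam exprS mulVKf.
have := phase_value_ge q0 (leq_trans k3 kn) mu_distr marg3 (leq_trans _ k3) kn kq v0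
  lam1 klam h_le h_gt tq' q'q nq2 nt ep0 sd.
move=> /(_ isT); apply: le_trans; rewrite ler_wpM2r ?top_value_ge0 //.
(* The 87 is [3 + 84]: [6 * ep * lam] equals [3 * kap * (3 / 4) ^ j], and [kap ^ 3 * k = 1] turns
   the other loss into [84 * kap * (4 / 9) ^ j]. *)
have e1 : ep * lam = kap / 2 * (3 / 4) ^+ j.
  rewrite /ep /lam exprS.
  have -> : (3 / 4 : R) ^+ j = (3 / 2) ^+ j * 2^-1 ^+ j.
    by rewrite -exprMn; congr (_ ^+ _); lra.
  by ring.
have e2 : 84 / (ep ^+ 2 * k%:R) = 84 * kap * (4 / 9) ^+ j.
  have -> : (4 / 9 : R) ^+ j = ((3 / 2) ^+ j) ^- 2.
    by rewrite -exprM mulnC exprM -exprVn; congr (_ ^+ _); lra.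
  have kn0 : kap != 0 by rewrite lt0r_neq0.
  have c0 : (3 / 2 : R) ^+ j != 0 by rewrite expf_neq0 // lt0r_neq0 // divr_gt0.
  have -> : k%:R = kap ^- 3 by apply: (mulfI (expf_neq0 3 kn0)); rewrite kap3 divff ?expf_neq0.
  by rewrite /ep; field; rewrite c0 kn0.
have e3 : (4 / 9 : R) ^+ j <= (3 / 4) ^+ j.
  by rewrite lerXn2r ?nnegrE; lra.
have e4 : 84 * kap * (4 / 9) ^+ j <= 84 * kap * (3 / 4) ^+ j.
  by rewrite ler_wpM2l // mulr_ge0 // ltW.
rewrite /level_gain -/lam e2; move: e1 e4; lra.
Qed.

(** Badly split choices of [tau] have total mass at most [1 / k ^ 2]. As the claimed value does not
    exceed [top_value], discarding them costs at most [top_value / k ^ 2]. *)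
Lemma level_step j q' (L : R) : (2 ^ j.+1 <= k)%N -> (q' <= q)%N ->
  near_level j q' ->
  (forall t, (t <= q')%N -> near_level j.+1 t -> L <= level_value j.+1 t) ->
  L + level_gain j * top_value <= top_value ->
  L + level_gain j * top_value - top_value / k%:R ^+ 2 <= level_value j q'.
Proof.
move=> jk q'q nq' HL XV; set X := L + _ in XV *.
have K0 : 0 < k%:R :> R by rewrite ltr0n.
have K2 : 0 < k%:R ^+ 2 :> R by rewrite exprn_gt0.
have Q0 : 0 < q%:R :> R by rewrite ltr0n.
have VK : 0 <= top_value / k%:R ^+ 2 by rewrite divr_ge0 ?top_value_ge0 // ltW.
case: (leP 0 X) => X0; last first.
  by apply: le_trans (level_value_ge0 j q'); move: X0 VK; lra.
(* [q' = 0] would be off by [2^-1 ^+ j >= 2 / k], beyond the tolerance. *)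
have q'0 : (0 < q')%N.
  rewrite lt0n; apply/eqP => q'e; move: nq'.
  rewrite /near_level q'e mul0r sub0r normrN ger0_norm ?exprn_ge0 ?invr_ge0 //.
  rewrite exprVn lef_pV2 ?posrE ?exprn_gt0 // -natrX ler_nat leqNgt.
  by rewrite (leq_trans _ jk) // expnS mul2n -addnn -addn1 leq_add2l expn_gt0.
have kj : (1 < k %/ 2 ^ j)%N by rewrite leq_divRL ?expn_gt0 // -expnS.
have hE : (k %/ 2 ^ j)./2 = (k %/ 2 ^ j.+1)%N.
  by rewrite -divn2 -divnMA -expnSr.
set r := rank_cut k (kap * (3 / 2) ^+ j).
set w := fun t : nat => minn q' (t + window q (2^-1 ^+ j.+1) (kap * (3 / 2) ^+ j)).
have wq t : (t <= q')%N -> (t <= w t <= q')%N 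
  by move=> tq; rewrite leq_min tq leq_addr geq_minl.
pose T t := \sum_x v x * prob mu (fun pi => good v blk pi (k %/ 2 ^ j)./2 r t (w t) x).
have T0 t : 0 <= T t.
  apply: sumr_ge0 => x _; rewrite mulr_ge0 //.
  by apply: sumr_ge0 => pi _; apply: mu_distr.1.
have step : \sum_(t < q'.+1) dbinomial R q' t * (level_value j.+1 t + T t) <=
    level_value j q'.
  rewrite /level_value /T -hE.
  under eq_bigr do rewrite -big_split /= mulr_sumr.
  rewrite exchange_big /=; apply: ler_sum => x _.
  rewrite /expect mulr_sumr.
  under eq_bigr do rewrite probE -mulrDr -big_split /= mulrA mulr_sumr.
  rewrite exchange_big /=; apply: ler_sum => pi _.
  have := sel_step blkE pi r kj (_ : (0 < q' <= q)%N) wq (v0 x).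
  rewrite q'0 q'q => /(_ isT) H.
  rewrite mulrCA; apply: le_trans (ler_wpM2l (mu_distr.1 pi) H).
  rewrite mulr_sumr le_eqVlt; apply/orP; left; apply/eqP; apply: eq_bigr => t _.
  by rewrite -mulrDr; ring.
apply: le_trans step.
(* For this deviation Chebyshev gives [q' * k ^ 2 / q ^ 2 <= k ^ 2 / q], which is at most
   [1 / k ^ 2] since [k ^ 4 <= q]. *)
pose c : R := q%:R / k%:R.
have c0 : 0 < c by rewrite divr_gt0.
have good_t (t : 'I_q'.+1) : ~~ (c < `|2 * t%:R - q'%:R|) -> near_level j.+1 t.
  rewrite -leNgt /near_level => tc.
  have e : (t%:R / q%:R - 2^-1 ^+ j.+1 : R) = (2 * t%:R - q'%:R) / (2 * q%:R)
      + 2^-1 * (q'%:R / q%:R - 2^-1 ^+ j).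
    by rewrite exprS; field; rewrite lt0r_neq0.
  rewrite e; apply: le_trans (ler_normD _ _) _.
  rewrite !normrM (gtr0_norm (_ : 0 < 2^-1)) ?invr_gt0 //.
  rewrite (gtr0_norm (_ : 0 < (2 * q%:R)^-1)); last by rewrite invr_gt0 mulr_gt0.
  have : `|2 * t%:R - q'%:R| * (2 * q%:R)^-1 <= k%:R^-1 / 2 :> R.
    rewrite ler_pdivrMr ?mulr_gt0 //; apply: le_trans tc _.
    by rewrite /c le_eqVlt; apply/orP; left; apply/eqP; field; rewrite lt0r_neq0.
  move: nq'; rewrite /near_level; lra.
have bad : \sum_(t : 'I_q'.+1 | c < `|2 * t%:R - q'%:R|) dbinomial R q' t <= k%:R ^- 2.
  apply: le_trans (dbinomial_chebyshev _ c0) _.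
  rewrite ler_pdivrMr ?exprn_gt0 //.
  have -> : k%:R ^- 2 * c ^+ 2 = (q%:R * q%:R) / k%:R ^+ 4 :> R.
    by rewrite /c; field; rewrite lt0r_neq0.
  rewrite ler_pdivlMr ?exprn_gt0 // -!natrX -!natrM ler_nat leq_mul //.
have split1 := sum_dbinomial R q'.
rewrite (bigID (fun t : 'I_q'.+1 => c < `|2 * t%:R - q'%:R|)) /= in split1.
apply: le_trans (_ : \sum_(t : 'I_q'.+1 | ~~ (c < `|2 * t%:R - q'%:R|))
   dbinomial R q' t * X <= _).
  rewrite -mulr_suml.
  have -> : \sum_(t : 'I_q'.+1 | ~~ (c < `|2 * t%:R - q'%:R|)) dbinomial R q' t =
    1 - \sum_(t : 'I_q'.+1 | c < `|2 * t%:R - q'%:R|) dbinomial R q' t.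
    by apply: (canRL (addrK _)); rewrite addrC.
  have : k%:R ^- 2 * X <= top_value / k%:R ^+ 2.
    by rewrite mulrC ler_wpM2r // invr_ge0 ltW.
  move: (ler_wpM2r X0 bad); lra.
rewrite big_mkcond /=; apply: ler_sum => t _; case: ifP => [/good_t nt|_]; last first.
  by rewrite mulr_ge0 ?dbinomial_ge0 // addr_ge0 // level_value_ge0.
have tq : (t <= q')%N by rewrite -ltnS.
rewrite ler_wpM2l ?dbinomial_ge0 // lerD ?HL //.
by apply: level_phase; rewrite ?tq.
Qed.

Lemma level_bound J d j q' : (2 ^ J <= k)%N -> (j + d = J)%N -> (q' <= q)%N ->
  near_level j q' ->
  (2^-1 ^+ j - 2^-1 ^+ J - 348 * kap * (3 / 4) ^+ j - d%:R / k%:R ^+ 2) * top_value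
    <= level_value j q'.
Proof.
move=> Jk; elim: d j q' => [|d IH] j q' jd q'q nq'.
  apply: le_trans (level_value_ge0 j q'); rewrite mulr_le0_ge0 ?top_value_ge0 //.
  rewrite -jd addn0 subrr mul0r subr0 sub0r oppr_le0 !mulr_ge0 ?exprn_ge0 //.
  exact: ltW.
have K2 : 0 < k%:R ^+ 2 :> R by rewrite exprn_gt0 // ltr0n.
have jk : (2 ^ j.+1 <= k)%N by apply: leq_trans Jk; rewrite leq_exp2l // -jd addnS ltnS leq_addr.
set L := (2^-1 ^+ j.+1 - 2^-1 ^+ J - 348 * kap * (3 / 4) ^+ j.+1
          - d%:R / k%:R ^+ 2) * top_value.
have HL t : (t <= q')%N -> near_level j.+1 t -> L <= level_value j.+1 t.
  by move=> tq; apply: IH; rewrite ?addSnnS // (leq_trans tq).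
have V0 := top_value_ge0.
have E : L + level_gain j * top_value =
    (2^-1 ^+ j - 2^-1 ^+ J - 348 * kap * (3 / 4) ^+ j - d%:R / k%:R ^+ 2) * top_value.
  rewrite /L /level_gain !exprS -mulrDl; congr (_ * _); field.
  by rewrite pnatr_eq0 -lt0n.
have XV : L + level_gain j * top_value <= top_value.
  rewrite E -[leRHS]mul1r ler_wpM2r //.
  have a1 : 2^-1 ^+ j <= 1 :> R by rewrite exprn_ile1 //; lra.
  have a2 : 0 <= 2^-1 ^+ J :> R by rewrite exprn_ge0 //; lra.
  have a3 : 0 <= d%:R / k%:R ^+ 2 :> R by rewrite divr_ge0 // ltW.
  have a4 : 0 <= 348 * kap * (3 / 4) ^+ j.
    apply: mulr_ge0; first exact: mulr_ge0 (ler0n _ _) (ltW kap0).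
    by rewrite exprn_ge0 // divr_ge0.
  lra.
apply: le_trans (level_step jk q'q nq' HL XV); rewrite E.
have -> : d.+1%:R / k%:R ^+ 2 = d%:R / k%:R ^+ 2 + (k%:R ^+ 2)^-1 :> R.
  by rewrite -natr1 mulrDl mul1r.
by rewrite le_eqVlt; apply/orP; left; apply/eqP; ring.
Qed.

End Levels.

(** * Assembly of the final bound *)

Lemma expected_valE (R : realType) n k q (mu : 'S_n -> R) (v : 'I_n -> R) :
  expected_val k q mu v = \sum_x v x * expect mu (fun pi => psel v pi n k q x).
Proof.
rewrite /expected_val /expect sum_dbind.
under [RHS]eq_bigr do rewrite mulr_sumr.
rewrite exchange_big /=; apply: eq_bigr => pi _.
rewrite /val_set; under eq_bigr do rewrite big_mkcond mulr_sumr.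
rewrite exchange_big mulr_sumr /=; apply: eq_bigr => x _.
rewrite mulrCA; congr (_ * _); rewrite /psel probE mulr_sumr.
by apply: eq_bigr => S _; case: (x \in S); rewrite ?mulr1 ?mulr0 // mulrC.
Qed.

Lemma expected_val_ge0 (R : realType) n k q (mu : 'S_n -> R) (v : 'I_n -> R) :
  is_distr mu -> (forall x, 0 <= v x) -> 0 <= expected_val k q mu v.
Proof.
move=> [mu0 _] v0; rewrite expected_valE; apply: sumr_ge0 => x _.
by rewrite mulr_ge0 //; apply: sumr_ge0 => pi _; rewrite mulr_ge0 ?psel_ge0.
Qed.

(** Level 0 with all [q] blocks is the algorithm itself. Here [351 = 348 + 2 + 1]: the last level is
    dropped at a cost [2^-1 ^+ J <= 2 / k], the bad splits cost [J / k ^ 2 <= 1 / k], and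
    [1 / k = kap ^ 3 <= kap]. *)
Lemma expected_val_ge (R : realType) n k p q (delta kap : R) (mu : 'S_n -> R)
    (v : 'I_n -> R) :
  (3 <= k)%N -> (k <= p)%N -> (p <= n)%N -> (q %| n)%N -> (k ^ 4 <= q)%N ->
  9 * k%:R ^+ 3 * delta <= 1 -> 0 < kap -> kap ^+ 3 * k%:R = 1 ->
  is_distr mu -> block_independent p q delta mu -> (forall x, 0 <= v x) ->
  (1 - 351 * kap) * val_set v (top_items v k) <= expected_val k q mu v.
Proof.
move=> k3 kp pn qn k4q sd kap0 kap3 mu_distr [blk cons ind] v0.
have q0 : (0 < q)%N by apply: leq_trans k4q; rewrite expn_gt0 (leq_trans _ k3).
have marg3 : block_marginal blk mu delta 3.
  exact: block_marginal_le (leq_trans k3 kp) pn ind.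
have blkE := consecutive_blocks_ltn q0 qn cons.
have kn := leq_trans kp pn.
have V0 := top_value_ge0 k v0.
have Q0 : q%:R != 0 :> R by rewrite pnatr_eq0 -lt0n.
have K1 : 1 <= k%:R :> R by rewrite ler1n (leq_trans _ k3).
set J := trunc_log 2 k.
have /andP[Jk kJ] : (2 ^ J <= k < 2 ^ J.+1)%N 
  by apply: trunc_log_bounds => //; apply: leq_trans k3.
have nq : near_level R q k 0 q.
  by rewrite /near_level divff // expr0 subrr normr0 invr_ge0.
have := level_bound blkE mu_distr marg3 k3 kn k4q v0 sd kap0 kap3 Jk (add0n J)
  (leqnn q) nq.
rewrite !expr0 mulr1 => bound.
have -> : val_set v (top_items v k) = top_value k v.
  by apply: eq_bigl => x; rewrite inE.
apply: le_trans (_ : level_value k (n %/ q) v blk mu 0 q <= _); last first.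
  rewrite expected_valE; apply: ler_sum => x _; rewrite ler_wpM2l //.
  apply: ler_sum => pi _; rewrite ler_wpM2l ?mu_distr.1 //.
  by rewrite /sel ltn_ord mul1r expn0 divn1 mulnC divnK.
apply: le_trans bound; rewrite ler_wpM2r //.
have Kn0 : k%:R != 0 :> R by rewrite lt0r_neq0 //; lra.
have kap1 : kap <= 1.
  rewrite leNgt; apply/negP => k1.
  have : 1 < kap ^+ 3 by rewrite exprn_egt1.
  by nra.
have iK : k%:R^-1 <= kap.
  have -> : k%:R^-1 = kap ^+ 3 :> R.
    by apply: (mulIf Kn0); rewrite kap3 mulVf.
  by rewrite exprS ger_pMr // exprn_ile1 // ltW.
have a1 : 2^-1 ^+ J <= 2 * k%:R^-1 :> R.
  rewrite exprVn -[2 * _]invrK invfM invrK lef_pV2 ?posrE ?exprn_gt0 //; last first.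
    by rewrite mulr_gt0 // ?invr_gt0 //; lra.
  rewrite mulrC ler_pdivrMr // mulrC -exprS -natrX ler_nat; exact: ltnW.
have a2 : J%:R / k%:R ^+ 2 <= k%:R^-1 :> R.
  rewrite ler_pdivrMr ?exprn_gt0 //; last by lra.
  rewrite expr2 mulKf ?lt0r_neq0 //; last by lra.
  rewrite ler_nat; apply: leq_trans Jk; exact: ltnW (ltn_expl _ _).
lra.
Qed.

Theorem mainTheorem18 (R : realType) :
  exists (C : R) (eps : nat -> nat -> R -> R),
    [/\ 0 < C,
        (forall (k q : nat) (delta : R), 0 <= eps k q delta),
        (forall k : nat, (0 < k)%N ->
           ((fun z : nat * R => eps k z.1 z.2)
              @ filter_prod \oo (nbhs (0 : R)) --> (0 : R))%classic)
      & forall (n k p q : nat) (delta : R) (mu : 'S_n -> R) (v : 'I_n -> R),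
          (0 < k)%N -> (k <= p)%N -> (p <= n)%N -> (q %| n)%N ->
          delta <= k%:R `^ (- 2^-1) ->
          is_distr mu ->
          block_independent p q delta mu ->
          (forall x : 'I_n, 0 <= v x) ->
          (1 - C * k%:R `^ (- 3^-1) - eps k q delta) * val_set v (top_items v k)
            <= expected_val k q mu v].
Proof.
exists 351, (fun k q delta =>
  if (k ^ 4 <= q)%N && (9 * k%:R ^+ 3 * delta <= 1) then 0 else 1).
split=> // [k q delta|k k0|n k p q delta mu v k0 kp pn qn _ mu_distr ind v0].
- by case: ifP.
(* For fixed [k] both side conditions hold eventually along the product filter, so the error term is
   eventually the constant 0. *)
- apply: cvg_near_cst.
  exists ([set q | (k ^ 4 <= q)%N], [set d : R | 9 * k%:R ^+ 3 * d <= 1])%classic.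
    split=> /=; first exact: nbhs_infty_ge.
    have c0 : 0 < (9 * k%:R ^+ 3)^-1 :> R.
      by rewrite invr_gt0 mulr_gt0 // exprn_gt0 // ltr0n.
    near=> d; rewrite /= mulrC -ler_pdivlMr ?mul1r; last by rewrite -invr_gt0.
    apply: le_trans (ler_norm d) _; near: d; exact: (@nbhs0_le R R^o _ c0).
  by case=> q d /= [-> ->].
have Cov : 0 <= val_set v (top_items v k) by apply: sumr_ge0.
have triv c : c <= 0 -> c * val_set v (top_items v k) <= expected_val k q mu v.
  by move=> cn; apply: le_trans (expected_val_ge0 _ _ mu_distr v0); rewrite mulr_le0_ge0.
have K1 : 1 <= k%:R :> R by rewrite ler1n.
have kap0 : 0 < k%:R `^ (- 3^-1) :> R by rewrite powR_gt0; lra.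
have kap3 : (k%:R `^ (- 3^-1)) ^+ 3 * k%:R = 1 :> R.
  rewrite -powR_mulrn ?powR_ge0 // -powRrM.
  have -> : - 3^-1 * 3%:R = -1 :> R by lra.
  by rewrite powR_inv1 ?mulVf // ?lt0r_neq0 //; lra.
set kap := k%:R `^ (- 3^-1) in kap0 kap3 *.
case: ifP => [/andP[k4q sd]|_]; last by apply: triv; lra.
rewrite subr0; case: (leqP 3 k) => k3.
  exact: expected_val_ge kap0 kap3 mu_distr ind v0.
(* For [k <= 2] the factor [1 - 351 * kap] is nonpositive: otherwise [kap <= 1 / 2], and
   [kap ^ 3 * k <= 1 / 4] contradicts [kap3]. *)
apply: triv; have K2 : k%:R <= 2 :> R by rewrite ler_nat.
case: (leP 1 (351 * kap)) => [|kap_small]; first by lra.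
have : kap ^+ 3 <= 8^-1.
  have -> : 8^-1 = 2^-1 ^+ 3 :> R by rewrite !exprS expr0; lra.
  by rewrite lerXn2r ?nnegrE ?ltW //; lra.
by move: kap3; nra.
Unshelve. all: by end_near.
Qed.
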